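(* There exists (in ZFC) a subset $X$ of $[0,1]$ which is not a $G_\delta$ subset of $[0,1]$ and such that the space $P_r(X)$ of Borel probability Radon measures on $X$ is hereditarily Baire.
   Context: A topological space is Baire if the intersection of every countable family of open dense subsets is dense; it is hereditarily Baire if every closed subspace is Baire. For a topological space $X$, $P(X)$ is the space of all Borel probability measures on $X$ with the weak topology, in which basic neighborhoods of $\mu$ are the sets $\{\nu\in P(X):|\int f_i\,d\mu-\int f_i\,d\nu|<\varepsilon,\ i=1,\dots,n\}$ with $\varepsilon>0$ and $f_1,\dots,f_n$ bounded continuous real-valued functions on $X$. A measure $\mu\in P(X)$ is Radon if for each Borel set $B\subseteq X$ and each $\varepsilon>0$ there is a compact $K\subseteq B$ with $\mu(B\setminus K)<\varepsilon$. $P_r(X)$ is the subspace of $P(X)$ consisting of all Radon measures. The set $X\subseteq[0,1]$ carries the subspace topology. *)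

(* Defs.v *)
From HB Require Import structures.
From mathcomp Require Import all_boot all_order all_algebra.
From mathcomp Require Import all_classical all_reals all_analysis.

Set Implicit Arguments.
Unset Strict Implicit.
Unset Printing Implicit Defensive.

Import Order.TTheory GRing.Theory Num.Theory.
Import numFieldNormedType.Exports.

Local Open Scope classical_set_scope.
Local Open Scope ring_scope.

Definition baire_space (T : topologicalType) : Prop :=
  forall U : (set T)^nat, (forall n, open (U n)) -> (forall n, dense (U n)) ->
    dense (\bigcap_n U n).

(* The coercion of [F] to a type carries the subspace topology. *)
Definition hereditarily_baire (T : topologicalType) : Prop :=
  forall F : set T, closed F -> baire_space F.

(* A topological space with a distinguished point: [measurableType] requires
   its carrier to be pointed. The point is only a default value. *)
Definition pointed_at (T : topologicalType) (x0 : T) : Type := T.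

HB.instance Definition _ (T : topologicalType) (x0 : T) :=
  Topological.on (pointed_at x0).
HB.instance Definition _ (T : topologicalType) (x0 : T) :=
  isPointed.Build (pointed_at x0) x0.

Definition borel (T : ptopologicalType) := g_sigma_algebraType (@open T).

(* An element of [probability (borel T) R] is a function on all subsets of T,
   whose values on non-Borel sets carry no meaning. Setting these values to 0
   makes elements correspond one-to-one to Borel probability measures. *)
Record borel_probability (R : realType) (T : ptopologicalType) :=
  BorelProbability {
    bp_measure :> probability (borel T) R ;
    bp_nonborel : forall B : set (borel T), ~ measurable B -> bp_measure B = 0%E
  }.

HB.instance Definition _ (R : realType) (T : ptopologicalType) :=
  gen_eqMixin (borel_probability R T).
HB.instance Definition _ (R : realType) (T : ptopologicalType) :=
  gen_choiceMixin (borel_probability R T).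

Section WeakTopology.
Variables (R : realType) (T : ptopologicalType).
Implicit Types mu nu : borel_probability R T.

Definition weak_ball n (f : 'I_n -> T -> R) (eps : R) mu :
    set (borel_probability R T) :=
  [set nu | forall i, `|\int[mu]_(x in [set: borel T]) f i x -
                        \int[nu]_(x in [set: borel T]) f i x| < eps].

Definition weak_nbhs mu (A : set (borel_probability R T)) : Prop :=
  exists n (f : 'I_n -> T -> R) (eps : R),
    [/\ 0 < eps, forall i, continuous (f i), forall i, bounded_fun (f i) &
        weak_ball f eps mu `<=` A].

HB.instance Definition _ := hasNbhs.Build (borel_probability R T) weak_nbhs.

Let weak_ball_refl n (f : 'I_n -> T -> R) (eps : R) mu :
  0 < eps -> weak_ball f eps mu mu.
Proof. by move=> e0 i; rewrite subrr normr0. Qed.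

Let weak_nbhs_filter mu : ProperFilter (weak_nbhs mu).
Proof.
split.
  by move=> [n [f [e [e0 _ _]]]] /(_ mu); apply; exact: weak_ball_refl.
split.
- exists 0%N, (fun=> cst 0), 1; split=> //.
  + by move=> i; exact: cst_continuous.
  + by case.
- move=> A B [n [f [e [e0 cf bf fA]]]] [m [g [d [d0 cg bg gB]]]].
  exists (n + m)%N, (fun i : 'I_(n + m) => match fintype.split i with inl j => f j | inr j => g j end).
  exists (Num.min e d); split.
  + by rewrite lt_min e0.
  + by move=> i; case: fintype.split.
  + by move=> i; case: fintype.split.
  + move=> nu H; split.
    * apply: fA => i; have := H (lshift m i).
      by rewrite -[lshift m i]/(unsplit (inl i)) unsplitK lt_min => /andP[].
    * apply: gB => i; have := H (rshift n i).
      by rewrite -[rshift n i]/(unsplit (inr i)) unsplitK lt_min => /andP[].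
- move=> A B AB [n [f [e [e0 cf bf fA]]]].
  by exists n, f, e; split=> //; exact: subset_trans AB.
Qed.

Let weak_nbhs_singleton mu A : weak_nbhs mu A -> A mu.
Proof. by move=> [n [f [e [e0 _ _]]]]; apply; exact: weak_ball_refl. Qed.

Let weak_nbhs_nbhs mu A : weak_nbhs mu A -> weak_nbhs mu (weak_nbhs^~ A).
Proof.
move=> [n [f [e [e0 cf bf fA]]]].
exists n, f, (e / 2); split=> //; first by rewrite divr_gt0.
move=> nu munu; exists n, f, (e / 2); split=> //; first by rewrite divr_gt0.
move=> la nula; apply: fA => i.
rewrite [e]splitr; apply: le_lt_trans (ltrD (munu i) (nula i)).
exact: ler_distD.
Qed.

HB.instance Definition _ :=
  Nbhs_isNbhsTopological.Build (borel_probability R T)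
    weak_nbhs_filter weak_nbhs_singleton weak_nbhs_nbhs.

End WeakTopology.

Definition radon (R : realType) (T : ptopologicalType)
    (mu : borel_probability R T) : Prop :=
  forall (B : set (borel T)) (eps : R), measurable B -> 0 < eps ->
    exists K : set T,
      [/\ compact K, K `<=` B & (mu (B `\` K) < eps%:E)%E].

Definition radon_probability (R : realType) (T : ptopologicalType) :
    topologicalType :=
  [set mu : borel_probability R T | radon mu].

(* Main.v *)
Require Import Defs.
From HB Require Import structures.
From mathcomp Require Import all_boot all_order all_algebra.
From mathcomp Require Import all_classical all_reals all_analysis.
From mathcomp Require Import borel_hierarchy.
From mathcomp Require Import wochoice measurable_realfun zify lra.

Set Implicit Arguments.
Unset Strict Implicit.
Unset Printing Implicit Defensive.

Import Order.TTheory GRing.Theory Num.Theory.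
Import numFieldNormedType.Exports.

Local Open Scope classical_set_scope.
Local Open Scope ring_scope.

(** In the Cantor space let [Y] consist of the finite sets together with the
    ranges of a b-scale: strictly increasing functions [f_x], well-ordered by
    eventual domination and unbounded, such that every map from a proper initial
    segment of the scale to [nat -> nat] has bounded image. Such a [Y] is a
    Hurewicz space (Bartoszynski-Tsaban): any countable family of compact sets
    disjoint from [Y] can be separated from [Y] by a sigma-compact set. It is not
    sigma-compact: an unbounded closed subset would contain the ranges of two
    functions each exceeding the other infinitely often. Embed the Cantor space
    in [0, 1] and let [X] be the image of the complement of [Y].

    Given a closed set [F] of Radon measures on [X], choose a countable dense
    [D] in [F]. All measures in [D] live on one sigma-compact subset of [X], hence
    on a G-delta subset [G] of the Cantor space contained in [X]. The usual
    construction of a decreasing sequence of basic open sets, keeping the mass on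
    the open sets defining [G] close to 1, produces a sequence of measures whose
    limit along an ultrafilter is concentrated on [G]; so it is a Radon measure
    on [X], it lies in [F] and in all the given dense open sets. *)

(** * Scales *)

Section Scale.
Local Open Scope nat_scope.

Definition ev_le (f g : nat -> nat) := exists N, forall n, N <= n -> f n <= g n.

Lemma ev_le_trans f g h : ev_le f g -> ev_le g h -> ev_le f h.
Proof.
move=> [N fg] [M gh]; exists (maxn N M) => n; rewrite geq_max => /andP[Nn Mn].
exact: leq_trans (fg _ Nn) (gh _ Mn).
Qed.

Lemma le_ev_le f g : (forall n, f n <= g n) -> ev_le f g.
Proof. by exists 0. Qed.

Lemma not_ev_leP f g : ~ ev_le f g -> forall N, exists2 n, N <= n & g n < f n.
Proof.
move=> nfg N; apply: contrapT => H; apply: nfg; exists N => n Nn.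
by rewrite leqNgt; apply/negP => gf; apply: H; exists n.
Qed.

Lemma ev_le_countable (F : nat -> nat -> nat) : exists g, forall i, ev_le (F i) g.
Proof.
exists (fun n => \max_(i < n.+1) F i n) => i; exists i => n ni.
exact: (leq_bigmax (Ordinal (ni : i < n.+1))).
Qed.

Definition increasing (f : nat -> nat) := forall n, f n < f n.+1.

Lemma increasing_ge f n : increasing f -> n <= f n.
Proof. by move=> incf; elim: n => // n IH; exact: leq_ltn_trans IH (incf n). Qed.

Lemma increasing_lt f m n : increasing f -> m < n -> f m < f n.
Proof. by move=> incf; apply: (homo_ltn ltn_trans). Qed.

Lemma increasing_le f m n : increasing f -> m <= n -> f m <= f n.
Proof.
by move=> incf; rewrite leq_eqVlt => /predU1P[->//|mn]; exact/ltnW/increasing_lt.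
Qed.

Lemma exists_increasing_ge f : exists2 g, increasing g & forall n, f n <= g n.
Proof.
exists (fun n => \sum_(i < n.+1) (f i).+1) => n.
  by rewrite [ltnRHS]big_ord_recr /=; lia.
by rewrite big_ord_recr /=; lia.
Qed.

(** Expresses without cardinals that [A] has fewer than b elements, b being the least size of a
    family of functions unbounded for [ev_le]. *)
Definition small (W : Type) (A : set W) :=
  forall F : W -> nat -> nat, exists g, forall w, A w -> ev_le (F w) g.

Definition lt_of (T : Type) (r : rel T) (x y : T) : Prop := r x y /\ x <> y.

Lemma well_order_wf (T : eqType) (r : rel T) :
  well_order r -> well_founded (lt_of r).
Proof.
move=> wor x; apply: contrapT => nx.
have [|z [[]]] := wor [pred x | `[< ~ Acc (lt_of r) x >]].
  by exists x; apply/asboolP.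
move=> /asboolP nz lbz _; apply: nz; constructor=> y [ryz yz].
apply: contrapT => ny; apply: yz.
(* Antisymmetry of [r] on [y] and [z] comes from uniqueness of the least element of the pair: both
   points qualify. *)
have [w [_ uw]] := wor (pred2 y z) (ex_intro _ y (predU1l _ erefl)).
have rzy : r z y by apply: lbz; apply/asboolP.
have rxx u : r u u.
  have [v [[/eqP -> /(_ u (eqxx u)) //]]] := wor (pred1 u) (ex_intro _ u (eqxx u)).
transitivity w; [symmetry|]; apply: uw; split.
- by rewrite inE eqxx.
- by move=> u /orP[] /eqP ->.
- by rewrite inE eqxx orbT.
- by move=> u /orP[] /eqP ->.
Qed.

Lemma well_order_total (T : eqType) (r : rel T) :
  well_order r -> forall x y, [\/ x = y, lt_of r x y | lt_of r y x].
Proof.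
move=> wor x y.
have [<-|xy] := pselect (x = y); first by constructor 1.
have [z [[/orP[] /eqP -> lb] _]] := wor (pred2 x y) (ex_intro _ x (predU1l _ erefl)).
  by constructor 2; split => //; apply: lb; rewrite inE eqxx orbT.
by constructor 3; split; [apply: lb; rewrite inE eqxx|move/esym].
Qed.

Record scale (W : Type) (lt : W -> W -> Prop) (I : set W) (f : W -> nat -> nat) := Scale {
  scale_total : forall x y, [\/ x = y, lt x y | lt y x] ;
  scale_small : forall x, I x -> small (lt^~ x) ;
  scale_incr : forall x, I x -> increasing (f x) ;
  scale_le : forall x y, I x -> lt y x -> ev_le (f y) (f x) ;
  scale_unbounded : forall g, exists2 x, I x & ~ ev_le (f x) g }.

(** Well-order [nat -> nat] and let [I] collect the [x] whose strict initial segment is small. [I]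
    is not small: otherwise the least point outside [I] would have a small segment after all or,
    when [I] is everything, the identity would have a bounded image. So [I] indexes an unbounded
    family [h], and recursion makes [f x] dominate [h x] and all earlier [f y], smallness of the
    segment providing a bound. *)
Lemma exists_scale : exists W lt I f, @scale W lt I f.
Proof.
pose W : eqType := (nat -> nat)%type.
have [r wor] := well_ordering_principle W.
have wf := well_order_wf wor.
pose I : set W := [set x | small (lt_of r ^~ x)].
have Ilarge : ~ small I.
  have [[x nIx]|allI] := pselect (exists x, ~ I x).
    have {x nIx} [x nIx minx] : exists2 x, ~ I x & forall y, lt_of r y x -> I y.
      apply: contrapT => H; apply: nIx; elim/(well_founded_ind wf) : x => x IH.
      by apply: contrapT => nx; apply: H; exists x.
    move=> sI; apply: nIx => F; have [g gP] := sI F.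
    by exists g => y /minx/gP.
  move=> /(_ id)[g gP]; have /gP[N /(_ N (leqnn N))] : I (S \o g).
    by apply: contrapT => ?; apply: allI; exists (S \o g).
  by rewrite /= ltnn.
have [h hunb] : exists h : W -> nat -> nat,
    forall g, exists2 x, I x & ~ ev_le (h x) g.
  apply: contrapT => nh; apply: Ilarge => F.
  apply: contrapT => ng; apply: nh; exists F => g.
  apply: contrapT => nx; apply: ng; exists g => x Ix.
  by apply: contrapT => ?; apply: nx; exists x.
pose good x (F : forall y, lt_of r y x -> nat -> nat) : set W :=
  [set g | [/\ increasing g, ev_le (h x) g & forall y p, ev_le (F y p) g]].
(* The default is never taken at points of [I], by [fgood] below. *)
pose step x F := xget (fun=> 0) (@good x F).
pose f := Fix wf (fun=> nat -> nat) step.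
have fE x : f x = step x (fun y _ => f y).
  apply: Fix_eq => y F G FG; congr step.
  by apply/functional_extensionality_dep => z; apply/funext => p; exact: FG.
have fgood x : I x -> good x (fun y _ => f y) (f x).
  move=> Ix; rewrite fE /step; case: xgetP => [y -> //|] nogood; exfalso.
  have [g0 g0P] := Ix f.
  have [g gincr gP] := exists_increasing_ge (fun n => maxn (g0 n) (h x n)).
  apply: (nogood g); split=> //.
    by apply: le_ev_le => n; apply: leq_trans (gP n); rewrite leq_maxr.
  move=> y /g0P /ev_le_trans; apply.
  by apply: le_ev_le => n; apply: leq_trans (gP n); rewrite leq_maxl.
exists W, (lt_of r), I, f; split=> //.
- exact: well_order_total.
- by move=> x /fgood[].
- by move=> x y /fgood[_ _ H] yx; exact: H.
- move=> g; have [x Ix nx] := hunb g; exists x => // fg; apply: nx.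
  by have [_ hf _] := fgood _ Ix; exact: ev_le_trans hf fg.
Qed.

End Scale.

(** * A non-sigma-compact Hurewicz set in the Cantor space *)

Section CantorTopology.

Definition agree (n : nat) (x y : cantor_space) : Prop :=
  forall i, (i < n)%N -> x i = y i.

Lemma agree_sym n x y : agree n x y -> agree n y x.
Proof. by move=> xy i /xy. Qed.

Lemma agree_trans n x y z : agree n x y -> agree n y z -> agree n x z.
Proof. by move=> xy yz i ni; rewrite xy ?yz. Qed.

Lemma agree_le m n x y : (m <= n)%N -> agree n x y -> agree m x y.
Proof. by move=> mn xy i im; apply: xy; exact: leq_trans im mn. Qed.

Lemma nbhs_agree (x : cantor_space) n : nbhs x (agree n x).
Proof.
elim: n => [|n IH]; first by apply: filterS filterT.
have : nbhs x [set y : cantor_space | y n = x n].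
  apply: (@proj_continuous nat (fun=> bool) n x [set b | b = x n]).
  exact: (@discrete_set1 bool (x n)).
apply: filterS2 IH => y xy yx i; rewrite ltnS leq_eqVlt => /predU1P[->//|].
exact: xy.
Qed.

Lemma nbhs_agreeP (x : cantor_space) A : nbhs x A -> exists n, agree n x `<=` A.
Proof.
pose F : set_system cantor_space := filter_from [set: nat] (fun n => agree n x).
have FF : Filter F.
  apply: filter_from_filter; first by exists 0%N.
  move=> i j _ _; exists (maxn i j) => // y xy.
  by split; apply: agree_le xy; rewrite (leq_maxl, leq_maxr).
(* Convergence of this filter is checked one coordinate at a time, the product topology being a
   supremum of initial topologies. *)
suff Fx : F --> x by move=> /Fx[n _ nA]; exists n.
apply/cvg_sup => i; apply/cvg_image.
  by apply/seteqP; split=> // b _; exists (fun=> b).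
move=> A' xA'; exists [set y | A' (y i)].
  exists i.+1 => // y xy /=; rewrite -xy//; exact: nbhs_singleton xA'.
apply/seteqP; split => [_ [y yA' <-]//|b bA'].
by exists (fun=> b).
Qed.

Lemma openP (A : set cantor_space) :
  open A <-> forall x, A x -> exists n, agree n x `<=` A.
Proof.
rewrite openE; split => [oA x /oA/nbhs_agreeP//|H x /H[n nA]].
exact: filterS nA (nbhs_agree x n).
Qed.

Lemma closedP (A : set cantor_space) :
  closed A <-> forall x, (forall n, exists2 y, A y & agree n x y) -> A x.
Proof.
split => [cA x xA|H x clx].
  apply: cA => B /nbhs_agreeP[n nB].
  by have [y Ay xy] := xA n; exists y; split=> //; exact: nB.
by apply: H => n; have [y [Ay xy]] := clx _ (nbhs_agree x n); exists y.
Qed.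

End CantorTopology.

Section ScaleSet.
Variables (W : Type) (lt : W -> W -> Prop) (I : set W) (f : W -> nat -> nat).
Hypothesis S : scale lt I f.
Local Open Scope nat_scope.

Definition fin_supp : set cantor_space :=
  [set y | exists N, forall k, N <= k -> y k = false].

Definition range_of (h : nat -> nat) : cantor_space :=
  fun k => `[< exists n, h n = k >].

Definition scale_set : set cantor_space :=
  fin_supp `|` [set range_of (f x) | x in I].

Lemma range_ofP h k : reflect (exists n, h n = k) (range_of h k).
Proof. exact: asboolP. Qed.

Lemma range_of_gap (e h : nat -> nat) n :
    increasing h -> e (n + n).+1 <= h n ->
  exists2 j, n <= j <= n + n &
    forall k, e j <= k < e j.+1 -> range_of h k = false.
Proof.
move=> incrh; rewrite leqNgt => /negP H; apply: contrapT => nogap; apply: H.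
(* If the range meets the intervals numbered [n, ..., n + i], then [i + 1] of its
   points lie below [e (n + i + 1)]. *)
suff : forall i, i <= n -> h i < e (n + i).+1 by exact.
elim=> [|i IH] ni.
  apply: contrapT => nh; apply: nogap; exists n; first by lia.
  move=> k /andP[_ ke]; apply/negbTE/negP => /range_ofP[m mk].
  by apply: nh; rewrite addn0; have := @increasing_le _ 0 m incrh (leq0n _); lia.
apply: contrapT => nh; apply: nogap; exists (n + i.+1); first by lia.
move=> k /andP[ek ke]; apply/negbTE/negP => /range_ofP[m mk].
apply: nh; have [mi|im] := leqP m i.
  by have := increasing_le incrh mi; have := IH (ltnW ni); rewrite addnS in ek *; lia.
by have := increasing_le incrh im; lia.
Qed.

(** * Separating the scale set from countably many closed sets *)

Section Separation.
Variable K : nat -> set cantor_space.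
Hypothesis K_closed : forall n, closed (K n).
Hypothesis K_disj : forall n, K n `<=` ~` scale_set.

Definition free (y : cantor_space) m k :=
  forall z i, agree k y z -> i <= m -> ~ K i z.

Lemma free_mono y m k m' k' : m' <= m -> k <= k' -> free y m k -> free y m' k'.
Proof.
move=> mm kk fy z i yz im; apply: fy (leq_trans im mm).
exact: agree_le yz.
Qed.

Lemma free_exists y m : scale_set y -> exists k, free y m k.
Proof.
move=> yS; elim: m => [|m [k IH]].
  have /nbhs_agreeP[k kP] : nbhs y (~` K 0).
    by apply: open_nbhs_nbhs; split; [exact: closed_openC|move=> /K_disj].
  by exists k => z i yz; rewrite leqn0 => /eqP ->; exact: kP.
have /nbhs_agreeP[k' k'P] : nbhs y (~` K m.+1).
  by apply: open_nbhs_nbhs; split; [exact: closed_openC|move=> /K_disj].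
exists (maxn k k') => z i yz; rewrite leq_eqVlt => /predU1P[->|].
  by apply: k'P; apply: agree_le yz; exact: leq_maxr.
by apply: IH; apply: agree_le yz; exact: leq_maxl.
Qed.

(** Only finitely many points are supported below [m], so the largest of their lengths serves them
    all. The clause [m < k] makes the iterates in [free_scale_set] increasing. *)
Lemma free_fin m : exists k, m < k /\
  forall y : cantor_space, (forall i, m <= i -> y i = false) -> free y m k.
Proof.
pose yt (t : m.-tuple bool) : cantor_space := fun i => nth false t i.
have /choice[k kP] : forall t : m.-tuple bool, exists k, free (yt t) m k.
  move=> t; apply: free_exists; left; exists m => i mi.
  by rewrite /yt nth_default ?size_tuple.
exists (maxn m.+1 (\max_t k t)); split; first exact: leq_maxl.
move=> y ym; pose t := [tuple y i | i < m].
have -> : y = yt t.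
  apply/funext => i; rewrite /yt; have [im|mi] := ltnP i m.
    by rewrite -[i]/(val (Ordinal im)) nth_mktuple.
  by rewrite nth_default ?size_tuple// ym.
apply: free_mono (kP t) => //; apply: leq_trans (leq_maxr _ _).
exact: leq_bigmax.
Qed.

(** [G] is the maximum of three bounds. Let [e] iterate the function [g] from [free_fin]: a point
    vanishing on [[e j, e j.+1)] is free at level [e j] with length [e j.+1]. Choose [x0] with
    [f x0] above [e (n + n).+1] infinitely often; by [range_of_gap] every [f x] eventually above
    [f x0] has such gaps, with lengths bounded by [g2]. The indices before [x0] form a small set, so
    one [g3] eventually bounds their individual lengths. Finite supports are served by [g]
    itself. *)
Lemma free_scale_set : exists G, forall y, scale_set y ->
  exists N, forall m, N <= m -> free y m (G m).
Proof.
have /choice[g gP] := free_fin.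
pose e j := iter j g 0.
have e_incr : increasing e by move=> n; rewrite /e iterS; exact: (gP _).1.
have gfree (y : cantor_space) m :
    (forall i, m <= i < g m -> y i = false) -> free y m (g m).
  (* Freeness with length [g m] depends only on the first [g m] coordinates, so [y] may be cut off
     at [m]. *)
  move=> ym; pose y' : cantor_space := fun i => (i < m) && y i.
  have yy' : agree (g m) y' y.
    by move=> i ig; rewrite /y'; case: ltnP => //= mi; rewrite ym // mi.
  have : free y' m (g m).
    by apply: (gP _).2 => i mi; rewrite /y' ltnNge mi.
  by move=> fy' z i yz; apply: fy'; exact: agree_trans yz.
have [x0 Ix0 nx0] := scale_unbounded S (fun n => e (n + n).+1).
have /choice[q qP] : forall n, exists k, n <= k /\ e (k + k).+1 < f x0 k.
  by move=> n; have [k] := not_ev_leP nx0 n; exists k.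
pose g2 n := e (q n + q n).+1.
have late x : I x -> ev_le (f x0) (f x) ->
    exists N, forall m, N <= m -> free (range_of (f x)) m (g2 m).
  move=> Ix [N NP]; exists N => m Nm.
  have [mq fq] := qP m.
  have [|j /andP[nj jn] gap] := @range_of_gap e _ (q m) (scale_incr S Ix).
    by apply: leq_trans (ltnW fq) _; apply: NP; lia.
  apply: free_mono (gfree _ (e j) gap).
    by apply: leq_trans mq (leq_trans nj _); exact: increasing_ge.
  by rewrite -[g _]/(e j.+1); apply: increasing_le.
have /choice[psi psiP] : forall x, exists h : nat -> nat,
    I x -> forall m, free (range_of (f x)) m (h m).
  move=> x; have [Ix|] := pselect (I x); last by exists (fun=> 0).
  have /choice[h hP] : forall m, exists k, free (range_of (f x)) m k.
    by move=> m; apply: free_exists; right; exists x.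
  by exists h.
have [g3 g3P] := scale_small S Ix0 psi.
pose G m := maxn (g m) (maxn (g2 m) (g3 m)).
have gG m : g m <= G m by rewrite leq_maxl.
have g2G m : g2 m <= G m by rewrite /G maxnCA leq_maxl.
have g3G m : g3 m <= G m by rewrite /G maxnA leq_maxr.
exists G => y [[N yN]|[x Ix <-]].
  exists N => m Nm; apply: (free_mono (leqnn m) (gG m)).
  by apply: gfree => i /andP[mi _]; apply: yN; exact: leq_trans mi.
have early : lt x x0 -> exists N, forall m, N <= m -> free (range_of (f x)) m (G m).
  move=> /g3P[N NP]; exists N => m /NP pm.
  by apply: free_mono (psiP x Ix m) => //; exact: leq_trans pm _.
have {}late : ev_le (f x0) (f x) ->
    exists N, forall m, N <= m -> free (range_of (f x)) m (G m).
  move=> /(late _ Ix)[N NP]; exists N => m /NP; exact: free_mono.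
have [xx0|/early//|x0x] := scale_total S x x0.
  by apply: late; rewrite xx0; apply: le_ev_le => n.
by apply: late; exact: (scale_le S Ix x0x).
Qed.

(* The sigma-compact set separating [scale_set] from the [K n] is the union over
   [N] of the sets [y | forall m >= N, free y m (G m)]. *)
Lemma scale_set_separation : exists O : nat -> set cantor_space,
  [/\ forall n, open (O n), forall n m, K n `<=` O m &
      \bigcap_n O n `<=` ~` scale_set].
Proof.
have [G GP] := free_scale_set.
exists (fun N => [set y | exists2 m, N <= m & ~ free y m (G m)]); split.
- move=> N; apply/openP => y [m Nm nf]; exists (G m) => z yz.
  exists m => // fz; apply: nf => w i yw; apply: fz.
  exact: agree_trans (agree_sym yz) yw.
- move=> n N y Ky; exists (maxn n N); first exact: leq_maxr.
  by move=> /(_ y n) H; apply: H => //; exact: leq_maxl.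
- move=> y Oy /GP[N NP]; have [m Nm] := Oy N Logic.I.
  by apply; exact: NP.
Qed.

End Separation.

(** * The scale set is not F-sigma *)

Lemma range_of_inj h h' : increasing h -> increasing h' ->
  range_of h = range_of h' -> h = h'.
Proof.
have aux n u v : increasing u -> increasing v -> range_of u = range_of v ->
    (forall m, m < n -> u m = v m) -> u n < v n -> False.
  move=> iu iv uv IH unvn.
  have /range_ofP[m um] : range_of v (u n) by rewrite -uv; apply/range_ofP; exists n.
  have mn : m < n.
    by rewrite ltnNge; apply/negP => /(increasing_le iv); lia.
  by have := increasing_lt iu mn; have := IH _ mn; lia.
move=> ih ih' hh'; apply/funext => n; elim/ltn_ind: n => n IH.
have [hlt|hgt|//] := ltngtP (h n) (h' n); first by case: (aux n h h').
by case: (aux n h' h) => // m mn; rewrite IH.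
Qed.

Definition dominated (A : set W) := exists g, forall x, A x -> ev_le (f x) g.

Lemma sub_dominated A B : A `<=` B -> dominated B -> dominated A.
Proof. by move=> AB [g gP]; exists g => x /AB/gP. Qed.

Lemma dominated_bigcup (T : countType) (A : T -> set W) :
  (forall t, dominated (A t)) -> dominated (\bigcup_t A t).
Proof.
move=> /choice[g gP].
have [G GP] := ev_le_countable (fun n => if unpickle n is Some t then g t else id).
exists G => x [t _ /gP] /ev_le_trans; apply.
by have := GP (pickle t); rewrite pickleK.
Qed.

Lemma dominatedU A B : dominated A -> dominated B -> dominated (A `|` B).
Proof.
move=> dA dB.
apply: sub_dominated (@dominated_bigcup bool (fun b => if b then A else B) _).
  by move=> x [Ax|Bx]; [exists true|exists false].
by case.
Qed.

Section Fsigma.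
Variable C : set cantor_space.
Hypotheses (C_closed : closed C) (C_sub : C `<=` scale_set).

Let D : set W := [set x | I x /\ C (range_of (f x))].
Let Dpre (s : seq nat) : set W := [set x | D x /\ mkseq (f x) (size s) = s].
(** A kernel of Cantor-Bendixson type, with dominated sets in the role of countable ones. *)
Let core : set W := [set x | D x /\ forall k, ~ dominated (Dpre (mkseq (f x) k))].

(** The points of [D] outside the core are covered by the dominated sets among the countably many
    [Dpre t]. *)
Let core_not_dominated s : ~ dominated (Dpre s) -> ~ dominated (core `&` Dpre s).
Proof.
move=> nd dc; apply: nd.
pose A t : set W := [set x | dominated (Dpre t) /\ Dpre t x].
have dA : dominated (\bigcup_t A t).
  apply: dominated_bigcup => t.
  have [dt|ndt] := pselect (dominated (Dpre t)).
    by apply: sub_dominated dt => x [].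
  by exists id => x [].
apply: sub_dominated (dominatedU dc dA) => x [Dx xs].
have [xc|xc] := pselect (core x); [by left|right].
apply: contrapT => nA; apply: xc; split=> // k dk; apply: nA.
by exists (mkseq (f x) k) => //; split=> //; split; rewrite // size_mkseq.
Qed.

(** The core points sharing the first [k] values of [f x] are not all eventually below [f y], so one
    of them exceeds it at some place beyond [k]. *)
Let core_step x y k : core x -> core y -> exists x' j,
  [/\ core x', forall i, i < k -> f x i = f x' i, k <= j & f y j < f x' j].
Proof.
move=> [_ /(_ k)/core_not_dominated nd] yc.
apply: contrapT => H; apply: nd; exists (f y) => x' [x'c [_ xx']].
apply: contrapT => /not_ev_leP/(_ k)[j kj yj]; apply: H; exists x', j.
split=> // i ik; move: xx'; rewrite size_mkseq => /(congr1 (nth 0 ^~ i)).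
by rewrite !nth_mkseq.
Qed.

(** The limit function [u] is increasing and its range lies in the closed set [C], hence in
    [scale_set]. Being infinite, this range is that of some [f a], and an increasing function is
    determined by its range. *)
Let limit (x : nat -> W) (k : nat -> nat) : (forall n, core (x n)) ->
    (forall n, k n < k n.+1) ->
    (forall n i, i < k n -> f (x n) i = f (x n.+1) i) ->
  exists2 a, I a & forall n i, i < k n -> f (x n) i = f a i.
Proof.
move=> xc incrk xk.
have xkd n d i : i < k n -> f (x n) i = f (x (n + d)) i.
  move=> ik; elim: d => [|d IH]; first by rewrite addn0.
  rewrite IH addnS; apply: xk; apply: leq_trans ik _.
  by apply: increasing_le => //; exact: leq_addr.
have xI n : I (x n) by have [[]] := xc n.
have kn n : n <= k n by exact: increasing_ge.
(* Position [i] is already frozen at stage [i.+1], since [i < k i.+1]. *)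
pose u i := f (x i.+1) i.
have xu n i : i < k n -> f (x n) i = u i.
  move=> ik; have [ni|ni] := leqP n i.+1.
    by rewrite (xkd n (i.+1 - n))// subnKC.
  by rewrite /u (xkd i.+1 (n - i.+1)) ?(leq_trans _ (kn _))// subnKC// ltnW.
have iu : increasing u.
  move=> n; rewrite -!(xu n.+2); first exact: (scale_incr S (xI _)).
    by apply: leq_trans (kn _).
  by apply: leq_trans (kn _).
have Cu : C (range_of u).
  apply: (proj1 (closedP C) C_closed) => n.
  exists (range_of (f (x n))); first by have [[]] := xc n.
  (* An increasing function takes a value below [n] only at an argument below [n], where [f (x n)]
     and [u] agree. *)
  move=> i ni; apply/range_ofP/range_ofP => -[m mi]; exists m; rewrite -mi.
    by rewrite xu//; have := increasing_ge m iu; have := kn n; lia.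
  by rewrite xu//; have := increasing_ge m (scale_incr S (xI n)); have := kn n; lia.
have [[N uN]|[a Ia ua]] := C_sub Cu.
  have := uN _ (increasing_ge N iu).
  by move/negbT/negP; case; apply/range_ofP; exists N.
exists a => // n i ik; rewrite xu//; congr (_ i).
by apply/esym/range_of_inj => //; exact: (scale_incr S Ia).
Qed.

(** Otherwise the core is inhabited. Extending two core points alternately, each time making one
    exceed the other at a new place, gives in the limit [a] and [b] such that neither of [f a],
    [f b] is eventually below the other, against totality of the scale. *)
Lemma dominated_closed : dominated D.
Proof.
have [//|nD] := pselect (dominated D); exfalso.
have [x0 x0c] : core !=set0.
  apply/set0P/eqP => c0; apply: (@core_not_dominated [::]).
    by apply: contra_not nD; apply: sub_dominated => x Dx; split.
  by rewrite c0 set0I; exists id.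
pose T := {x : W * W * nat | core x.1.1 /\ core x.1.2}.
have /choice[st stP] : forall t : T, exists t' : T,
    [/\ forall i, i < (sval t).2 -> f (sval t).1.1 i = f (sval t').1.1 i,
        forall i, i < (sval t).2 -> f (sval t).1.2 i = f (sval t').1.2 i,
        exists2 j, (sval t).2 <= j < (sval t').2 &
          f (sval t').1.2 j < f (sval t').1.1 j &
        exists2 j, (sval t).2 <= j < (sval t').2 &
          f (sval t').1.1 j < f (sval t').1.2 j].
  move=> [[[x y] k] [/= xc yc]].
  have [x' [j [x'c xx' kj yj]]] := core_step k xc yc.
  have [y' [j' [y'c yy' jj' xj']]] := core_step j.+1 yc x'c.
  exists (exist _ ((x', y'), j'.+1) (conj x'c y'c)); split=> //=.
  - by move=> i ik; apply: yy'; lia.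
  - by exists j; [lia|rewrite -yy'].
  - by exists j'; [lia|].
pose t n := iter n st (exist _ ((x0, x0), 0) (conj x0c x0c)).
pose k n := (sval (t n)).2.
have kincr n : k n < k n.+1.
  by have [_ _ [j /andP[kj jk] _] _] := stP (t n); exact: leq_ltn_trans kj jk.
have [a Ia xa] : exists2 a, I a & forall n i, i < k n -> f (sval (t n)).1.1 i = f a i.
  apply: limit => // n; first by have [] := svalP (t n).
  by have [] := stP (t n).
have [b Ib yb] : exists2 b, I b & forall n i, i < k n -> f (sval (t n)).1.2 i = f b i.
  apply: limit => // n; first by have [] := svalP (t n).
  by have [] := stP (t n).
have kn n : n <= k n by exact: increasing_ge.
have nab : ~ ev_le (f a) (f b).
  move=> [N NP]; have [_ _ [j /andP[kj jk]] + _] := stP (t N).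
  by rewrite (xa N.+1 j jk) (yb N.+1 j jk) ltnNge NP// (leq_trans (kn N)).
have nba : ~ ev_le (f b) (f a).
  move=> [N NP]; have [_ _ _ [j /andP[kj jk]]] := stP (t N).
  by rewrite (xa N.+1 j jk) (yb N.+1 j jk) ltnNge NP// (leq_trans (kn N)).
have [ab|ab|ab] := scale_total S a b.
- by apply: nab; rewrite ab; apply: le_ev_le.
- by apply: nab; exact: (scale_le S Ib ab).
- by apply: nba; exact: (scale_le S Ia ab).
Qed.

End Fsigma.

Lemma scale_set_not_Fsigma : ~ Fsigma scale_set.
Proof.
move=> [C cC SC].
have CS n : C n `<=` scale_set by rewrite SC; exact: bigcup_sup.
have /dominated_bigcup[g gP] := fun n => dominated_closed (cC n) (@CS n).
have [x Ix] := scale_unbounded S g; apply; apply: gP.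
have : scale_set (range_of (f x)) by right; exists x.
by rewrite SC => -[n _ Cn]; exists n.
Qed.

End ScaleSet.

Lemma exists_separable_non_Gdelta : exists2 X : set cantor_space, ~ Gdelta X &
  forall K : nat -> set cantor_space, (forall n, closed (K n)) ->
    (forall n, K n `<=` X) -> exists O : nat -> set cantor_space,
      [/\ forall n, open (O n), forall n m, K n `<=` O m & \bigcap_n O n `<=` X].
Proof.
have [W [lt [I [f S]]]] := exists_scale.
exists (~` scale_set I f); last exact: (scale_set_separation S).
move=> [U oU XU]; apply: (scale_set_not_Fsigma S).
exists (fun n => ~` U n); first by move=> n; exact: open_closedC.
by rewrite -setC_bigcap -XU setCK.
Qed.

(** * Embedding the Cantor space in the unit interval *)

Section CantorEmbedding.
Variable R : realType.

Definition cantor_sum (x : cantor_space) (n : nat) : R :=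
  \sum_(i < n) (x i)%:R * 3^-1 ^+ i.+1.

(** A ternary expansion with digits 0 and 1, so the image is the middle-thirds Cantor set scaled by
    one half. *)
Definition cantor_real (x : cantor_space) : R := sup (range (cantor_sum x)).

Let third_gt0 n : 0 < (3^-1 : R) ^+ n.
Proof. by rewrite exprn_gt0. Qed.

Let third_le m n : (m <= n)%N -> (3^-1 : R) ^+ n <= 3^-1 ^+ m.
Proof. by move=> mn; apply: ler_wiXn2l => //; lra. Qed.

Lemma cantor_sumS x n :
  cantor_sum x n.+1 = cantor_sum x n + (x n)%:R * 3^-1 ^+ n.+1.
Proof. by rewrite /cantor_sum big_ord_recr. Qed.

Lemma cantor_sum_tail x n m :
  cantor_sum x m <= cantor_sum x n + 3^-1 ^+ n / 2.
Proof.
(* The upper bound carries the exact geometric sum, so that the induction closes. *)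
have tail d : cantor_sum x n <= cantor_sum x (n + d) <=
    cantor_sum x n + (3^-1 ^+ n - 3^-1 ^+ (n + d)) / 2.
  elim: d => [|d /andP[IH1 IH2]]; first by rewrite addn0; lra.
  rewrite addnS cantor_sumS exprS; have := third_gt0 (n + d).
  by case: (x _) => /= ?; lra.
have [mn|nm] := leqP m n; last first.
  have := tail (m - n)%N; rewrite subnKC 1?ltnW//.
  by have := third_gt0 m; lra.
have {}tail : cantor_sum x m <= cantor_sum x n.
  rewrite -(subnKC mn); elim: (n - m)%N => [|d IH]; first by rewrite addn0.
  apply: (le_trans IH); rewrite addnS cantor_sumS lerDl.
  by rewrite mulr_ge0// ltW.
by have := third_gt0 n; lra.
Qed.

Lemma cantor_real_bounds x n :
  cantor_sum x n <= cantor_real x <= cantor_sum x n + 3^-1 ^+ n / 2.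
Proof.
have hs : has_ubound (range (cantor_sum x)).
  by exists (cantor_sum x 0 + 3^-1 ^+ 0 / 2) => _ [m _ <-]; exact: cantor_sum_tail.
apply/andP; split; first by apply: ub_le_sup => //; exists n.
apply: ge_sup; first by exists (cantor_sum x 0), 0%N.
by move=> _ [m _ <-]; exact: cantor_sum_tail.
Qed.

Lemma cantor_real_itv x : 0 <= cantor_real x <= 1.
Proof.
by have := cantor_real_bounds x 0; rewrite /cantor_sum big_ord0 expr0; lra.
Qed.

Lemma agree_cantor_sum n x y : agree n x y -> cantor_sum x n = cantor_sum y n.
Proof. by move=> xy; apply: eq_bigr => i _; rewrite xy. Qed.

Lemma agree_cantor_real n x y : agree n x y ->
  `|cantor_real x - cantor_real y| <= 3^-1 ^+ n / 2.
Proof.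
move=> /agree_cantor_sum xy; rewrite ler_norml.
by have := cantor_real_bounds x n; have := cantor_real_bounds y n; rewrite xy; lra.
Qed.

(** At the first disagreement [i] the digit contributes [3^-1 ^+ i.+1], and the remaining tail can
    undo at most half of it. *)
Lemma cantor_real_agree n x y :
  `|cantor_real x - cantor_real y| < 3^-1 ^+ n / 2 -> agree n x y.
Proof.
have aux i u v : agree i u v -> u i -> ~~ v i ->
    3^-1 ^+ i.+1 / 2 <= cantor_real u - cantor_real v.
  move=> /agree_cantor_sum uv ui /negbTE vi.
  have := cantor_real_bounds u i.+1; have := cantor_real_bounds v i.+1.
  by rewrite !cantor_sumS uv ui vi /=; lra.
move=> xyn; elim/ltn_ind => i IH ni.
have xyi : agree i x y by move=> j ji; apply: IH => //; exact: ltn_trans ji ni.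
have ni3 := third_le ni.
case xi : (x i); case yi : (y i) => //; exfalso.
- have := aux i x y xyi xi (negbT yi); have := ler_norm (cantor_real x - cantor_real y).
  by lra.
- have := aux i y x (agree_sym xyi) yi (negbT xi).
  by have := ler_norm (cantor_real y - cantor_real x); rewrite distrC; lra.
Qed.

Lemma cantor_real_inj : injective cantor_real.
Proof.
move=> x y xy; apply/funext => i; apply: (@cantor_real_agree i.+1 x y) => //.
by rewrite xy subrr normr0 divr_gt0.
Qed.

Lemma nbhs_cantor_real x A : nbhs (cantor_real x) A ->
  exists n, forall y, agree n x y -> A (cantor_real y).
Proof.
move=> /nbhs_ballP[e /= e0 eA].
have [n ne] : exists n, (3^-1 : R) ^+ n < e.
  have /cvgrPdist_lt/(_ _ e0) : (fun n => (3^-1 : R) ^+ n) @ \oo --> 0.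
    by apply: cvg_expr; rewrite ger0_norm; lra.
  by move=> [N _ /(_ N (leqnn N))]; rewrite /= sub0r normrN gtr0_norm//; exists N.
exists n => y /agree_cantor_real xy; apply: eA.
by rewrite /ball/=; have := third_gt0 n; lra.
Qed.

Lemma cantor_real_continuous : continuous cantor_real.
Proof.
move=> x A /nbhs_cantor_real[n nA]; rewrite /fmap /=.
by apply: filterS (nbhs_agree x n) => y /nA.
Qed.

End CantorEmbedding.

(** * The weak topology in terms of masses of cylinders *)

Definition cylinder (s : seq bool) : set cantor_space :=
  [set x | mkseq x (size s) = s].

Lemma mkseq_agree n (x y : cantor_space) : mkseq x n = mkseq y n <-> agree n x y.
Proof.
split=> [xy i ni|xy].
  by have := congr1 (nth false ^~ i) xy; rewrite !nth_mkseq.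
by apply/eq_in_map => i; rewrite mem_iota add0n => /andP[_ /xy ->].
Qed.

Lemma cylinder_agree s x y : agree (size s) x y -> cylinder s x -> cylinder s y.
Proof.
rewrite /cylinder /= => xy xs; rewrite -[RHS]xs.
exact/mkseq_agree/agree_sym.
Qed.

Lemma cylinder_mkseqP n (x y : cantor_space) : cylinder (mkseq x n) y <-> agree n x y.
Proof.
rewrite /cylinder /= size_mkseq; split=> [/esym/mkseq_agree//|xy].
exact/esym/mkseq_agree.
Qed.

(* The topology of [T] is the one induced by [psi], which need not be injective. *)
Definition cantor_coordinates (T : topologicalType) (psi : T -> cantor_space) :=
  forall t A, nbhs t A <-> exists n, [set u | agree n (psi t) (psi u)] `<=` A.

Lemma cantor_coordinates_id : cantor_coordinates (@id cantor_space).
Proof.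
move=> x A; split=> [/nbhs_agreeP//|[n nA]].
exact: filterS nA (nbhs_agree x n).
Qed.

Section Boxes.
Variables (R : realType) (T : ptopologicalType) (psi : T -> cantor_space).
Hypothesis psiP : cantor_coordinates psi.

Lemma borel_open (A : set (borel T)) : @open T A -> measurable A.
Proof. by move=> oA; exact: sub_sigma_algebra. Qed.

Lemma coordinates_preimage_open (O : set cantor_space) :
  open O -> open (psi @^-1` O).
Proof.
move=> /openP oO; rewrite openE => t /oO[n nO].
by apply/psiP; exists n => u; exact: nO.
Qed.

Lemma cylinder_open s : open (cylinder s).
Proof.
by apply/openP => x xs; exists (size s) => y xy; exact: cylinder_agree xs.
Qed.

Definition cyl s : set (borel T) := psi @^-1` (cylinder s).

Lemma cyl_measurable s : measurable (cyl s).
Proof. by apply: borel_open; apply: coordinates_preimage_open; exact: cylinder_open. Qed.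
Hint Resolve cyl_measurable : core.

Definition mass (nu : set (borel T) -> \bar R) (s : seq bool) : R := fine (nu (cyl s)).

Lemma massE (nu : probability (borel T) R) s : nu (cyl s) = (mass nu s)%:E.
Proof. by rewrite /mass fineK// fin_num_measure. Qed.

Lemma mass_ge0 (nu : probability (borel T) R) s : 0 <= mass nu s.
Proof. by rewrite -lee_fin -massE measure_ge0. Qed.

(** Rational thresholds on finite words leave only countably many boxes. Lower bounds suffice: the
    total mass is 1 and the complement of a cylinder is a finite union of cylinders, so masses get
    bounded from above too. *)
Definition box := seq (seq bool * rat).

Definition in_box (w : box) (nu : set (borel T) -> \bar R) : Prop :=
  forall p, p \in w -> ratr p.2 < mass nu p.1.

Lemma in_box_cat w w' nu : in_box (w ++ w') nu <-> in_box w nu /\ in_box w' nu.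
Proof.
split=> [H|[H H'] p]; first by split=> p pw; apply: H; rewrite mem_cat pw ?orbT.
by rewrite mem_cat => /orP[/H|/H'].
Qed.

Section LowerSemicontinuous.
Variable f : T -> R.
Hypothesis f_ge0 : forall t, 0 <= f t.
Hypothesis f_lsc : forall t a, a < f t ->
  exists n, forall u, agree n (psi t) (psi u) -> a < f u.

(** Over an empty cylinder the infimum is 0, so [c] is nonnegative throughout. The step functions
    [g n] increase to [f]. *)
Let c (s : seq bool) : R := inf (f @` cyl s).
Let g (n : nat) (t : borel T) : R := c (mkseq (psi t) n).

Let cyl_prefix n t : cyl (mkseq (psi t) n) t.
Proof. exact/cylinder_mkseqP. Qed.

Let c_ge0 s : 0 <= c s.
Proof.
rewrite /c; have [->|/set0P ne] := eqVneq (f @` cyl s) set0; first by rewrite inf0.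
by apply: lb_le_inf => // _ [t _ <-].
Qed.

Let c_le s t : cyl s t -> c s <= f t.
Proof.
move=> st; apply: ge_inf; last by exists t.
by exists 0 => _ [u _ <-].
Qed.

Let le_c n t a : (forall u, agree n (psi t) (psi u) -> a <= f u) -> a <= g n t.
Proof.
move=> H; apply: lb_le_inf; first by exists (f t), t => //; exact: cyl_prefix.
by move=> _ [u /cylinder_mkseqP tu <-]; exact: H.
Qed.

Let gE n t : g n t = \sum_(s : n.-tuple bool) c s * \1_(cyl s) t.
Proof.
pose s0 : n.-tuple bool := Tuple (introT eqP (size_mkseq (psi t) n)).
rewrite (bigD1 s0) //= big1 ?addr0; last first.
  move=> s ss0; rewrite indicE memNset ?mulr0//; apply: contraNnot ss0.
  by rewrite /cyl /cylinder /= size_tuple => ts; apply/eqP/val_inj; rewrite /= ts.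
by rewrite indicE mem_set ?mulr1//; exact: cyl_prefix.
Qed.

Let g_le_f n t : g n t <= f t.
Proof. by apply: c_le; exact: cyl_prefix. Qed.

Let g_homo t : {homo g^~ t : n m / (n <= m)%N >-> n <= m}.
Proof.
move=> n m nm; apply: le_c => u tu; apply: c_le.
by apply/cylinder_mkseqP; exact: agree_le nm tu.
Qed.

Let g_cvg t : g^~ t @ \oo --> f t.
Proof.
apply/cvgrPdist_le => e e0.
have [n nP] : exists n, forall u, agree n (psi t) (psi u) -> f t - e < f u.
  by apply: f_lsc; lra.
exists n => // m /= nm; have := g_le_f m t.
have : f t - e <= g m t.
  apply: le_trans (g_homo t nm); apply: le_c => u /nP/ltW//.
by rewrite ler_norml; lra.
Qed.

Let g_meas n : measurable_fun setT (EFin \o g n).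
Proof.
apply/measurable_EFinP.
have -> : g n = fun t => \sum_(s : n.-tuple bool) c s * \1_(cyl s) t.
  by apply/funext => t; exact: gE.
by apply: measurable_sum => s; apply: measurable_funM => //; exact: measurable_indic.
Qed.

Lemma lsc_measurable : measurable_fun [set: borel T] (f : borel T -> R).
Proof.
apply/measurable_EFinP; apply: (emeasurable_fun_cvg (fun n => EFin \o g n)) => // t _.
by apply/cvg_EFin; [exact: nearW|exact: g_cvg].
Qed.

Let g_int n (nu : probability (borel T) R) :
  (\int[nu]_t (g n t)%:E = (\sum_(s : n.-tuple bool) c s * mass nu s)%:E)%E.
Proof.
under eq_integral do rewrite gE -sumEFin.
rewrite ge0_integral_sum//; last 2 first.
- by move=> s; apply/measurable_EFinP/measurable_funM => //; exact: measurable_indic.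
- by move=> s t _; rewrite lee_fin mulr_ge0// indicE.
rewrite -sumEFin; apply: eq_bigr => s _.
under eq_integral do rewrite EFinM.
rewrite ge0_integralZl_EFin//; last by apply/measurable_EFinP; exact: measurable_indic.
by rewrite integral_indic// setIT EFinM; congr (_ * _)%E; exact: massE.
Qed.

(** By monotone convergence the integral of some [g n] already exceeds [r]. It is a nonnegative
    combination of cylinder masses, so lower bounds on these masses keep it, and with it the
    integral of [f], above [r]. *)
Lemma lsc_integral_box (nu : probability (borel T) R) r :
    (r%:E < \int[nu]_t (f t)%:E)%E ->
  exists w, in_box w nu /\ forall nu' : probability (borel T) R, in_box w nu' ->
    (r%:E < \int[nu']_t (f t)%:E)%E.
Proof.
move=> rf.
have cvg_int : (\int[nu]_t (g n t)%:E)%E @[n --> \oo] --> (\int[nu]_t (f t)%:E)%E.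
  have -> : (\int[nu]_t (f t)%:E = \int[nu]_t (limn (fun n => (g n t)%:E)))%E.
    apply: eq_integral => t _; apply/esym/cvg_lim => //.
    by apply/cvg_EFin; [exact: nearW|exact: g_cvg].
  apply: (@cvg_monotone_convergence _ _ _ nu setT measurableT
    (fun n t => (g n t)%:E)) => //.
  - by move=> n t _; rewrite lee_fin; exact: c_ge0.
  - by move=> t _ n m nm; rewrite lee_fin g_homo.
have [n] : exists n, (r%:E < \int[nu]_t (g n t)%:E)%E.
  have /cvg_int : nbhs (\int[nu]_t (f t)%:E)%E [set y | (r%:E < y)%E].
    by apply: open_nbhs_nbhs; split => //; exact: open_ereal_gt_ereal.
  by move=> [n _ /(_ n (leqnn n))]; exists n.
rewrite g_int lte_fin => rn.
pose S := \sum_(s : n.-tuple bool) c s.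
have S0 : 0 <= S by apply: sumr_ge0.
(* Lowering every mass by [d] costs [S * d], less than the available gap; the [+ 1] also covers
   [S = 0]. *)
pose d := (\sum_(s : n.-tuple bool) c s * mass nu s - r) / (S + 1).
have d0 : 0 < d by rewrite divr_gt0 ?subr_gt0//; lra.
have /choice[q qP] : forall s : n.-tuple bool, exists q : rat,
    mass nu s - d < ratr q < mass nu s.
  move=> s; have [|q] := @rat_in_itvoo R (mass nu s - d) (mass nu s); first lra.
  by rewrite in_itv/=; exists q.
exists [seq (val s, q s) | s <- enum {: n.-tuple bool}]; split.
  by move=> _ /mapP[s _ ->] /=; have /andP[] := qP s.
move=> nu' nu'w; apply: lt_le_trans (_ : (\int[nu']_t (g n t)%:E <= _)%E); last first.
  apply: ge0_le_integral => //.
  - by move=> t _; rewrite lee_fin; exact: c_ge0.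
  - exact: (g_meas n).
  - by apply/measurable_EFinP; exact: lsc_measurable.
  - by move=> t _; rewrite lee_fin; exact: g_le_f.
rewrite g_int lte_fin.
apply: lt_le_trans (_ : \sum_(s : n.-tuple bool) c s * (mass nu s - d) <= _); last first.
  apply: ler_sum => s _; apply: ler_wpM2l => //.
  have : ratr (q s) < mass nu' s.
    by apply: (nu'w (val s, q s)); apply/mapP; exists s => //; rewrite mem_enum.
  by have := qP s; lra.
under eq_bigr do rewrite mulrBr.
rewrite sumrB -mulr_suml -/S.
have : d * (S + 1) = \sum_(s : n.-tuple bool) c s * mass nu s - r.
  by rewrite /d divfK// gt_eqF// ltr_wpDl.
rewrite mulrDr mulr1 [S * d]mulrC; lra.
Qed.

End LowerSemicontinuous.

Lemma indic_lsc (O : set T) : open O -> forall t a, a < \1_O t :> R ->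
  exists n, forall u, agree n (psi t) (psi u) -> a < \1_O u :> R.
Proof.
move=> oO t a; have [a0 _|a0] := ltP a 0.
  by exists 0%N => u _; apply: (lt_le_trans a0); rewrite indicE.
have [/set_mem tO|tO] := boolP (t \in O); last first.
  by rewrite indicE (negbTE tO) /= => /(le_lt_trans a0); rewrite ltxx.
have : nbhs t O by exact: open_nbhs_nbhs.
move=> /psiP[n nO] at1; exists n => u /nO uO.
by move: at1; rewrite !indicE !mem_set.
Qed.

(** The open-set half of the portmanteau theorem: the indicator of an open set is lower
    semicontinuous. *)
Lemma open_box (O : set (borel T)) (nu : probability (borel T) R) r :
  @open T O -> (r%:E < nu O)%E ->
  exists w, in_box w nu /\ forall nu' : probability (borel T) R, in_box w nu' ->
    (r%:E < nu' O)%E.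
Proof.
move=> oO; have mO := borel_open oO.
have intO (nu' : probability (borel T) R) : (\int[nu']_t (\1_O t)%:E = nu' O)%E.
  by rewrite integral_indic// setIT.
rewrite -intO => /lsc_integral_box[].
- by move=> t; rewrite indicE.
- exact: indic_lsc.
- by move=> w [wnu wO]; exists w; split=> // nu' /wO; rewrite intO.
Qed.

End Boxes.

(** * Boxes form a base of the weak topology *)

Section WeakBase.
Variables (R : realType) (T : ptopologicalType) (psi : T -> cantor_space).
Hypothesis psiP : cantor_coordinates psi.

Lemma continuous_lsc (f : T -> R) : continuous f -> forall t a, a < f t ->
  exists n, forall u, agree n (psi t) (psi u) -> a < f u.
Proof.
move=> cf t a af; have : nbhs t [set u | a < f u].
  apply: (cf t [set x : R | a < x]).
  by apply: open_nbhs_nbhs; split => //; exact: open_gt.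
by move=> /psiP[n nh]; exists n => u /nh.
Qed.

Lemma bounded_funP (f : T -> R) :
  bounded_fun f <-> exists M : R, forall t, `|f t| <= M.
Proof.
split=> [[M [_ MP]]|[M fM]].
  by exists (M + 1) => t; apply: (MP (M + 1)) => //; rewrite ltrDl.
exists M; split; first exact: num_real.
by move=> N MN t _ /=; exact: le_trans (fM t) (ltW MN).
Qed.

Lemma continuous_integrable (f : T -> R) (nu : probability (borel T) R) :
  continuous f -> bounded_fun f -> nu.-integrable [set: borel T] (EFin \o f).
Proof.
move=> cf bf; have [M fM] := (bounded_funP f).1 bf.
pose h t := f t + M.
have h0 t : 0 <= h t by have := fM t; rewrite ler_norml /h; lra.
have ch : continuous h by move=> t; apply: cvgD; [exact: cf|exact: cvg_cst].
have mh := lsc_measurable psiP h0 (continuous_lsc ch).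
apply: measurable_bounded_integrable => //.
  by rewrite (le_lt_trans (probability_le1 nu measurableT)) ?ltry.
have -> : f = (h \- cst M) by apply/funext => t; rewrite /= /h addrK.
exact: measurable_funB.
Qed.

(** Adding a bound [M] makes [f] nonnegative and shifts every integral by [M], since the measures
    have total mass 1. *)
Lemma continuous_box (f : T -> R) (mu : probability (borel T) R) (e : R) :
    continuous f -> bounded_fun f -> 0 < e ->
  exists w, in_box psi w mu /\ forall nu : probability (borel T) R,
    in_box psi w nu ->
    \int[mu]_(x in [set: borel T]) f x - e < \int[nu]_(x in [set: borel T]) f x.
Proof.
move=> cf bf e0; have [M fM] := (bounded_funP f).1 bf.
pose h t := f t + M.
have h0 t : 0 <= h t by have := fM t; rewrite ler_norml /h; lra.
have ch : continuous h by move=> t; apply: cvgD; [exact: cf|exact: cvg_cst].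
have inth (nu : probability (borel T) R) :
    (\int[nu]_t (h t)%:E = (\int[nu]_(x in [set: borel T]) f x + M)%:E)%E.
  have bh : bounded_fun h.
    apply/bounded_funP; exists (M + M) => t.
    by have := fM t; rewrite /h !ler_norml; lra.
  rewrite -(fineK (integrable_fin_num measurableT (continuous_integrable nu ch bh))).
  congr EFin; rewrite -[LHS]/(\int[nu]_(x in [set: borel T]) (f x + cst M x)).
  rewrite RintegralD//; first last.
  - exact: (finite_measure_integrable_cst nu).
  - exact: continuous_integrable.
  by rewrite Rintegral_cst// [X in fine X](probability_setT nu) mulr1.
have [|w [wmu wnu]] := @lsc_integral_box _ _ _ psiP h h0 (continuous_lsc ch)
    mu (\int[mu]_(x in [set: borel T]) f x - e + M).
  by rewrite inth lte_fin; lra.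
by exists w; split=> // nu /wnu; rewrite inth lte_fin; lra.
Qed.

Lemma indic_continuous s : continuous (\1_(cyl psi s) : T -> R).
Proof.
move=> t A /nbhs_singleton At; rewrite /fmap /=.
apply/psiP; exists (size s) => u tu /=.
suff -> : \1_(cyl psi s) u = \1_(cyl psi s) t :> R by [].
rewrite !indicE; congr (nat_of_bool _)%:R; apply/idP/idP => /set_mem H; apply/mem_set.
  by apply: cylinder_agree H; exact: agree_sym.
exact: cylinder_agree H.
Qed.

Lemma in_box_nbhs w (mu : borel_probability R T) :
  in_box psi w mu -> nbhs mu [set nu : borel_probability R T | in_box psi w nu].
Proof.
elim: w => [|p w IH] wmu; first by apply: filterS filterT.
have {IH} IH : nbhs mu [set nu : borel_probability R T | in_box psi w nu].
  by apply: IH => q qw; apply: wmu; rewrite inE qw orbT.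
have : nbhs mu [set nu : borel_probability R T | ratr p.2 < mass psi nu p.1].
  have pmu := wmu p (mem_head _ _).
  exists 1%N, (fun=> \1_(cyl psi p.1)), (mass psi mu p.1 - ratr p.2); split.
  - by rewrite subr_gt0.
  - move=> _; exact: indic_continuous.
  - move=> _; apply/bounded_funP; exists 1 => t.
    by rewrite indicE; case: (_ \in _); rewrite ?normr1 ?normr0.
  - have intc (nu : borel_probability R T) :
        \int[nu]_(x in [set: borel T]) \1_(cyl psi p.1) x = mass psi nu p.1.
      rewrite /Rintegral integral_indic// ?setIT//; exact: cyl_measurable.
    move=> nu /(_ ord0); rewrite !intc /= => /(le_lt_trans (ler_norm _)); lra.
apply: filterS2 IH => nu H1 H2 q; rewrite inE => /predU1P[->//|/H1//].
Qed.

Lemma weak_nbhs_box (mu : borel_probability R T) A : nbhs mu A ->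
  exists w, in_box psi w mu /\
    forall nu : borel_probability R T, in_box psi w nu -> A nu.
Proof.
move=> [n [f [e [e0 cf bf fA]]]].
have /choice[w wP] : forall i, exists w, in_box psi w mu /\
    forall nu : borel_probability R T, in_box psi w nu ->
    `|\int[mu]_(x in [set: borel T]) f i x - \int[nu]_(x in [set: borel T]) f i x| < e.
  move=> i.
  have [w [wmu wnu]] := continuous_box mu (cf i) (bf i) e0.
  (* A lower bound for the integral of the negated function is an upper bound for that of [f i]. *)
  have [||w' [w'mu w'nu]] := @continuous_box (fun t => -1 * f i t) mu e _ _ e0.
  - by move=> t; apply: cvgM; [exact: cvg_cst|exact: cf].
  - have [M fM] := (bounded_funP (f i)).1 (bf i).
    by apply/bounded_funP; exists M => t; rewrite normrM normrN1 mul1r.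
  exists (w ++ w'); split; first by apply/in_box_cat.
  move=> nu /in_box_cat[/wnu + /w'nu].
  rewrite !RintegralZl//; [|exact: continuous_integrable..].
  by rewrite ltr_norml; lra.
exists (flatten [seq w i | i <- enum 'I_n]); split.
  by move=> p /flattenP[_ /mapP[i _ ->]]; have [+ _] := wP i; apply.
move=> nu H; apply: fA => i; apply: (wP i).2 => p pw; apply: H.
by apply/flattenP; exists (w i) => //; apply/mapP; exists i; rewrite // mem_enum.
Qed.

End WeakBase.

(** * Existence and regularity of measures *)

Section ProbabilityTools.
Variables (R : realType).

Lemma exists_pushforward d d' (S : measurableType d) (T : measurableType d')
    (P : probability S R) (X : S -> T) : measurable_fun setT X ->
  exists Q : probability T R, forall A, Q A = P (X @^-1` A).
Proof.
move=> mX; pose mmX := isMeasurableFun.Build _ _ _ _ X mX.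
pose Y : {mfun S >-> T} := HB.pack X mmX.
by exists (distribution P Y).
Qed.

Lemma probability_setI1 d (T : measurableType d) (P : probability T R) A B :
  measurable A -> measurable B -> P B = 1%E -> P (A `&` B) = P A.
Proof.
move=> mA mB PB; rewrite [RHS](measureDI P mA mB) -[LHS]add0e; congr (_ + _)%E.
apply/esym/eqP; rewrite eq_le measure_ge0 andbT.
have -> : 0%E = P (~` B) by rewrite probability_setC// PB subee.
apply: le_measure; rewrite ?inE; [exact: measurableD|exact: measurableC|].
by move=> x [].
Qed.

Lemma uniform_prob_itv (a b : R) : 0 <= a -> a <= b -> b <= 1 ->
  uniform_prob (@ltr01 R) `[a, b[ = (b - a)%:E.
Proof.
move=> a0 ab b1; rewrite /uniform_prob.
rewrite (eq_integral (fun=> 1%E)); last first.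
  move=> x; rewrite inE/= in_itv/= => /andP[ax xb].
  by rewrite /uniform_pdf subr0 invr1 (le_trans a0 ax) (ltW (lt_le_trans xb b1)).
rewrite integral_cst//= mul1e lebesgue_measure_itv/= lte_fin.
by case: ltP => // ba; rewrite (_ : b = a) ?subrr//; apply/eqP; rewrite eq_le ba.
Qed.

End ProbabilityTools.

(** * Measures on the Cantor space with prescribed cylinder masses *)

Section CantorMeasure.
Variables (R : realType) (p : seq bool -> R).
Hypotheses (p_ge0 : forall s, 0 <= p s) (p_nil : p [::] = 1).
Hypothesis p_rcons : forall s, p s = p (rcons s false) + p (rcons s true).

(* The cylinder of [s] is the set of codes of the points of
   [left s, left s + p s); children share this interval, [false] first. *)
Let left_step (sx : seq bool * R) (b : bool) : seq bool * R :=
  (rcons sx.1 b, sx.2 + (if b then p (rcons sx.1 false) else 0)).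

Let left_end (s : seq bool) : R := (foldl left_step ([::], 0) s).2.

Let left_rcons s b : left_end (rcons s b) =
  left_end s + (if b then p (rcons s false) else 0).
Proof.
rewrite /left_end foldl_rcons /=; congr (_ + (if b then p (rcons _ _) else _)).
by elim/last_ind: s => // s c IH; rewrite foldl_rcons /= IH.
Qed.

Let next (t : R) (s : seq bool) : bool := left_end s + p (rcons s false) <= t.

Let path (t : R) := fix path n :=
  if n is n'.+1 then rcons (path n') (next t (path n')) else [::].

Let code (t : R) : cantor_space := fun n => next t (path t n).

Let mkseq_code t n : mkseq (code t) n = path t n.
Proof. by elim: n => // n IH; rewrite mkseqS IH. Qed.

Let cylinder_code s t : cylinder s (code t) <-> path t (size s) = s.
Proof. by rewrite /cylinder /= mkseq_code. Qed.

Let left_itv s : 0 <= left_end s /\ left_end s + p s <= 1.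
Proof.
elim/last_ind: s => [|s b [IH1 IH2]]; first by rewrite /left_end /= p_nil; lra.
have := p_rcons s; have := p_ge0 (rcons s false); have := p_ge0 (rcons s true).
by rewrite left_rcons; case: b; lra.
Qed.

Let path_itv s t : 0 <= t < 1 ->
  path t (size s) = s <-> left_end s <= t < left_end s + p s.
Proof.
move=> t01; elim/last_ind: s => [|s b IH].
  by rewrite /left_end /= p_nil add0r; split.
rewrite size_rcons /= left_rcons; have := p_rcons s.
have := p_ge0 (rcons s false); have := p_ge0 (rcons s true) => ps1 ps0 psE.
split=> [/rcons_inj[/[dup] ss /IH]|H].
  by rewrite ss /next => sE; case: b => [/idP|/negbT]; rewrite -?ltNge /= => ?; lra.
have ss : path t (size s) = s by apply/IH; case: b H => /=; lra.
rewrite ss; congr rcons; rewrite /next.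
by case: b H => /= H; [apply/idP|apply/negbTE; rewrite -ltNge]; lra.
Qed.

Let measurable_path s : measurable [set t : R | path t (size s) = s].
Proof.
elim/last_ind: s => [|s b IH].
  by rewrite (_ : [set _ | _] = setT)//; apply/seteqP; split.
have -> : [set t | path t (size (rcons s b)) = rcons s b] =
    [set t | path t (size s) = s] `&`
    [set` if b then `[left_end s + p (rcons s false), +oo[
          else `]-oo, left_end s + p (rcons s false)[].
  apply/seteqP; split => t /=; rewrite size_rcons /=.
    move=> /rcons_inj[ss]; rewrite ss /next => <-; split=> //.
    by case: leP => /=; rewrite in_itv/= ?andbT.
  move=> [ss]; rewrite ss /next => H; congr rcons; move: H.
  by case: b => /=; rewrite in_itv/= ?andbT // ltNge => /negbTE.
by apply: measurableI => //; case: b.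
Qed.

(** The measure is the image of the uniform distribution under [code]: by [path_itv] the preimage of
    the cylinder of [s] meets [[0, 1)] in an interval of length [p s]. *)
Lemma exists_cantor_probability :
  exists m : probability (borel cantor_space) R, forall s, m (cylinder s) = (p s)%:E.
Proof.
have mcode : measurable_fun setT (code : measurableTypeR R -> borel cantor_space).
  apply: (@measurability _ _ _ (borel cantor_space) setT code
    (@open cantor_space) erefl) => _ [V oV <-].
  rewrite setTI.
  (* There are countably many finite words, so this union gives measurability of the preimage. *)
  have -> : code @^-1` V = \bigcup_(s in [set s | cylinder s `<=` V])
      [set t | path t (size s) = s].
    apply/seteqP; split => t /=.
      move=> /(proj1 (openP V) oV)[n nV]; exists (mkseq (code t) n) => /=.
        by move=> x /cylinder_mkseqP/nV.
      by rewrite size_mkseq mkseq_code.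
    by move=> [s /= sV /cylinder_code]; exact: sV.
  rewrite bigcup_mkcond; apply: countable_bigcupT_measurable => [|s].
    exact: countableP.
  by case: ifP.
pose P : probability (measurableTypeR R) R := uniform_prob (@ltr01 R).
have [m mE] := exists_pushforward P mcode.
exists m => s; rewrite mE.
have m01 : P `[0, 1[%classic = 1%E.
  by apply: (etrans (uniform_prob_itv _ _ _)) => //; rewrite subr0.
have -> : code @^-1` cylinder s = [set t | path t (size s) = s].
  by apply/seteqP; split => t /cylinder_code.
(* [path_itv] speaks of [[0, 1)] only, which has full measure. *)
transitivity (P ([set t | path t (size s) = s] `&` `[0, 1[)).
  apply/esym/probability_setI1; [exact: measurable_path|exact: measurable_itv|].
  exact: m01.
have [l0 l1] := left_itv s.
have -> : [set t | path t (size s) = s] `&` `[0, 1[ =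
    `[left_end s, left_end s + p s[%classic.
  apply/seteqP; split => t /=.
    by rewrite !in_itv/= => -[+ t01] => /(path_itv _ t01).
  rewrite !in_itv/= => H; have t01 : 0 <= t < 1 by lra.
  by split=> //; apply/path_itv.
apply: (etrans (uniform_prob_itv l0 _ l1)); first by rewrite lerDl.
by rewrite addrAC subrr add0r.
Qed.

End CantorMeasure.

Section ProbabilitySequences.
Variables (d : measure_display) (T : measurableType d) (R : realType).
Variable P : probability T R.

Lemma probability_increasing_approx (F : (set T)^nat) (e : R) :
    (forall n, measurable (F n)) -> (forall n, F n `<=` F n.+1) -> 0 < e ->
  exists n, (P (\bigcup_k F k `\` F n) < e%:E)%E.
Proof.
move=> mF incF e0; pose D n := \bigcup_k F k `\` F n.
have mU : measurable (\bigcup_k F k) by exact: bigcup_measurable.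
have mD n : measurable (D n) by exact: measurableD.
have D0 : \bigcap_n D n = set0.
  rewrite -subset0 => x xD; have [[k _ Fk] _] := xD 0%N Logic.I.
  by have [_] := xD k Logic.I; apply.
have homoF m n : (m <= n)%N -> F m `<=` F n.
  move=> /subnKC <-; elim: (n - m)%N => [|k IH]; rewrite ?addn0// addnS.
  exact: subset_trans (incF _).
have cvD : (P \o D) n @[n --> \oo] --> P (\bigcap_n D n).
  apply: nonincreasing_cvg_mu => //.
  - by rewrite (le_lt_trans (probability_le1 P (mD _))) ?ltry.
  - by rewrite D0; exact: measurable0.
  - move=> m n mn; apply/subsetPset => x [Ux nFn]; split=> // Fm.
    by apply: nFn; exact: homoF Fm.
have : nbhs (P (\bigcap_n D n)) [set y | (y < e%:E)%E].
  apply: open_nbhs_nbhs; split; first exact: open_ereal_lt_ereal.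
  by rewrite D0 /= measure0 lte_fin.
by move=> /cvD[n _ /(_ n (leqnn n))]; exists n.
Qed.

Lemma probability_bigcup_le (F : (set T)^nat) (e : R) :
    (forall n, measurable (F n)) -> 0 <= e ->
    (forall n, (P (F n) <= (e / (2 ^ n.+1)%:R)%:E)%E) ->
  (P (\bigcup_n F n) <= e%:E)%E.
Proof.
move=> mF e0 Fe; have mU : measurable (\bigcup_k F k) by exact: bigcup_measurable.
apply: le_trans (measure_sigma_subadditive P mF mU (@subset_refl _ _)) _.
apply: le_trans (epsilon_trick0 xpredT e0); apply: lee_nneseries => //.
by move=> n *; exact: Fe.
Qed.

Lemma probability_bigcap1 (F : (set T)^nat) :
  (forall n, measurable (F n)) -> (forall n, P (F n) = 1%E) -> P (\bigcap_n F n) = 1%E.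
Proof.
move=> mF F1; have mI : measurable (\bigcap_n F n) by exact: bigcapT_measurable.
have : P (\bigcup_n ~` F n) = 0%E.
  apply/eqP; rewrite eq_le measure_ge0 andbT.
  apply: (@probability_bigcup_le (fun n => ~` F n) 0) => // n.
    exact: measurableC.
  by rewrite probability_setC// F1 mul0r subee.
rewrite -setC_bigcap => H; rewrite -[X in P X]setCK.
by rewrite probability_setC ?H ?sube0//; exact: measurableC.
Qed.

Lemma probability_eq1 (B : set T) :
    measurable B -> (forall k, exists K : set T,
      [/\ measurable K, K `<=` B & (P (~` K) < (k.+1%:R^-1)%:E)%E]) ->
  P B = 1%E.
Proof.
pose p A : R := fine (P A).
have finE A : measurable A -> P A = (p A)%:E.
  by move=> mA; rewrite fineK// fin_num_measure.
move=> mB HK; apply/eqP; rewrite eq_le probability_le1//=.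
rewrite finE// lee_fin; apply/ler_addgt0Pr => e e0.
have [k ke] : exists k, (k.+1%:R^-1 : R) < e.
  exists (Num.truncn e^-1); rewrite invf_plt ?posrE// ?ltr0n//.
  exact: truncnS_gt.
have [K [mK KB Kk]] := HK k.
have pKB : p K <= p B.
  by rewrite -lee_fin -!finE//; apply: le_measure; rewrite ?inE.
have := Kk; rewrite probability_setC// finE// -EFinB lte_fin => /lt_trans/(_ ke).
by rewrite ltrBlDr => /ltW/le_trans; apply; rewrite addrC lerD2r.
Qed.

End ProbabilitySequences.

(** * Transfer, tightness and regularity of measures *)

Section Concentration.
Variables (R : realType) (T : ptopologicalType) (psi : T -> cantor_space).
Hypothesis psiP : cantor_coordinates psi.

Lemma open_coordinates (V : set T) : open V ->
  exists2 V' : set cantor_space, open V' & V = psi @^-1` V'.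
Proof.
move=> oV; exists [set x | exists t n, agree n (psi t) x /\
    [set u | agree n (psi t) (psi u)] `<=` V].
  apply/openP => x [t [n [tx nV]]]; exists n => y xy; exists t, n; split=> //.
  exact: agree_trans tx xy.
apply/seteqP; split=> [t tV|u [t [n [tu]]]]; last exact.
have /psiP[n nV] : nbhs t V by exact: open_nbhs_nbhs.
by exists t, n; split.
Qed.

Lemma coordinates_measurable : measurable_fun setT (psi : borel T -> borel cantor_space).
Proof.
apply: (@measurability _ _ _ (borel cantor_space) setT _ (@open cantor_space) erefl).
move=> _ [V oV <-]; rewrite setTI.
by apply: borel_open; exact: coordinates_preimage_open.
Qed.

(** A cluster point of the image filter lies in [A], hence has a preimage, which is a cluster point
    of the given filter because the topology of [T] comes from [psi]. *)
Lemma compact_coordinates (A : set cantor_space) :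
  closed A -> A `<=` range psi -> compact (psi @^-1` A).
Proof.
move=> cA Ar F PF FA.
have : compact A by apply: subclosed_compact cantor_space_compact _.
move=> /(_ (psi @ F) _ FA)[x [Ax Fx]].
have [t _ tx] := Ar _ Ax; exists t; split; first by rewrite /= tx.
move=> B C FB /psiP[n nC].
have FpB : F (psi @^-1` (psi @` B)) by apply: filterS FB => u Bu; exists u.
have [_ [[u Bu <-] xu]] := Fx (psi @` B) _ FpB (nbhs_agree x n).
by exists u; split=> //; apply: nC; rewrite /= tx.
Qed.

Section Inside.
Variable U : (set cantor_space)^nat.
Hypotheses (U_open : forall n, open (U n)) (U_sub : \bigcap_n U n `<=` range psi).

(** Push [m] forward along a section [g] of [psi] over [G], extended by the constant [point]. As [G]
    has full measure, [psi \o g] is almost surely the identity. *)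
Lemma transfer_probability (m : probability (borel cantor_space) R) :
  (forall n, m (U n) = 1%E) ->
  exists nu : probability (borel T) R,
    forall A : set (borel cantor_space), measurable A -> nu (psi @^-1` A) = m A.
Proof.
move=> mU; pose G : set (borel cantor_space) := \bigcap_n U n.
have mUn n : measurable (U n : set (borel cantor_space)) by exact: borel_open.
have mG : measurable G by exact: bigcapT_measurable.
have G1 : m G = 1%E by exact: probability_bigcap1.
have /choice[g gP] : forall x : cantor_space, exists t : T,
    (G x -> psi t = x) /\ (~ G x -> t = point).
  move=> x; have [Gx|nGx] := pselect (G x); last by exists point.
  by have [t _ tx] := U_sub Gx; exists t.
have mg : measurable_fun setT (g : borel cantor_space -> borel T).
  apply: (@measurability _ _ _ (borel T) setT _ (@open T) erefl).
  move=> _ [_ /open_coordinates[V oV ->] <-]; rewrite setTI.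
  have mV : measurable (V : set (borel cantor_space)) by exact: borel_open.
  (* Off [G] the map is constant, so that part of the preimage is all of the complement or empty. *)
  have -> : g @^-1` (psi @^-1` V) = (G `&` V) `|` (~` G `&` [set _ | V (psi point)]).
    apply/seteqP; split=> x /=.
      have [Gx|nGx] := pselect (G x).
        by rewrite ((gP x).1 Gx); left.
      by rewrite ((gP x).2 nGx); right.
    by move=> [[Gx]|[nGx]]; [rewrite ((gP x).1 Gx)|rewrite ((gP x).2 nGx)].
  apply: measurableU; first exact: measurableI.
  have [Vp|nVp] := pselect (V (psi point)).
    by rewrite (_ : [set _ | _] = setT) ?setIT; [exact: measurableC|apply/seteqP; split].
  by rewrite (_ : [set _ | _] = set0) ?setI0 //; apply/seteqP; split.
have [nu nuE] := exists_pushforward m mg.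
exists nu => A mA; rewrite nuE.
have mgA : measurable (g @^-1` (psi @^-1` A) : set (borel cantor_space)).
  rewrite -[X in measurable X]setTI; apply: mg => //.
  by rewrite -[X in measurable X]setTI; exact: coordinates_measurable.
rewrite -(probability_setI1 mgA mG G1) -(probability_setI1 mA mG G1).
congr (m _); apply/seteqP.
by split=> x [xA Gx]; split=> //; move: xA; rewrite /= ((gP x).1 Gx).
Qed.

Let inner (V : set cantor_space) n : set cantor_space := [set x | agree n x `<=` V].

Let inner_closed V n : closed (inner V n).
Proof.
apply/closedP => x /(_ n)[y yV xy] z xz; apply: yV.
exact: agree_trans (agree_sym xy) xz.
Qed.

Let bigcup_inner V : open V -> \bigcup_n inner V n = V.
Proof.
move=> /openP oV; apply/seteqP; split=> [x [n _]|x /oV[n nV]]; first exact.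
by exists n.
Qed.

Let measurable_preimage_closed (A : set cantor_space) :
  closed A -> measurable (psi @^-1` A : set (borel T)).
Proof.
move=> cA; rewrite -[X in measurable X]setTI; apply: coordinates_measurable => //.
by rewrite -[A]setCK; apply: measurableC; apply: borel_open; exact: closed_openC.
Qed.

Let measurable_preimage_open (A : set cantor_space) :
  open A -> measurable (psi @^-1` A : set (borel T)).
Proof. by move=> oA; apply: borel_open; exact: coordinates_preimage_open. Qed.

Lemma closed_inner_approx (nu : probability (borel T) R) (V : set cantor_space) e :
    open V -> 0 < e ->
  exists A, [/\ closed A, A `<=` V & (nu (psi @^-1` (V `\` A)) < e%:E)%E].
Proof.
move=> oV e0.
have [||n] := @probability_increasing_approx _ _ _ nu
    (fun n => psi @^-1` (inner V n)) e _ _ e0.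
- by move=> n; exact: measurable_preimage_closed.
- by move=> n t nV y ty; apply: nV; exact: agree_le ty.
rewrite -preimage_bigcup bigcup_inner// => nuV.
by exists (inner V n); split=> // x; exact.
Qed.

(** Inside each [U n] take a closed set losing at most [e / 2 ^ n.+1]. The intersection of these
    sets is closed and lies in every [U n], hence in the range of [psi]. *)
Lemma tight (nu : probability (borel T) R) e :
    (forall n, nu (psi @^-1` U n) = 1%E) -> 0 < e ->
  exists A, [/\ closed A, A `<=` range psi & (nu (psi @^-1` (~` A)) <= e%:E)%E].
Proof.
move=> nuU e0.
have /choice[A AP] : forall n, exists A, [/\ closed A, A `<=` U n &
    (nu (psi @^-1` (U n `\` A)) < (e / (2 ^ n.+1)%:R)%:E)%E].
  by move=> n; apply: closed_inner_approx => //; rewrite divr_gt0// ltr0n expn_gt0.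
have cA n : closed (A n) by have [] := AP n.
exists (\bigcap_n A n); split.
- exact: closed_bigI.
- by move=> x Ax; apply: U_sub => n _; have [_ + _] := AP n; apply; exact: Ax.
rewrite setC_bigcap preimage_bigcup; apply: probability_bigcup_le (ltW e0) _.
  by move=> n; apply: measurable_preimage_open; exact: closed_openC.
move=> n; have [_ _ /ltW] := AP n; apply: le_trans.
rewrite -[X in (X <= _)%E](probability_setI1 _ _ (nuU n)).
- by rewrite setIC.
- by apply: measurable_preimage_open; exact: closed_openC.
- exact: measurable_preimage_open.
Qed.

Definition regular_set (nu : probability (borel T) R) (B : set (borel T)) :=
  forall e, 0 < e -> exists C V : set cantor_space,
    [/\ closed C, open V, psi @^-1` C `<=` B, B `<=` psi @^-1` V &
        (nu (psi @^-1` (V `\` C)) <= e%:E)%E].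

(** The regular sets form a sigma-algebra containing the open sets. *)
Lemma borel_regular nu B : measurable B -> regular_set nu B.
Proof.
apply: (@smallest_sub _ (sigma_algebra setT) (@open T) (regular_set nu)); last first.
  move=> _ /open_coordinates[V oV ->] e e0.
  have [C [cC CV nuC]] := closed_inner_approx nu oV e0.
  by exists C, V; split=> //; [move=> t /CV|exact: ltW].
split.
- move=> e e0; exists set0, set0; split=> //; first exact: closed0.
    exact: open0.
  by rewrite setD0 preimage_set0 measure0 lee_fin ltW.
- move=> {}B rB e e0; have [C [V [cC oV CB BV nuCV]]] := rB e e0.
  exists (~` V), (~` C); split.
  + exact: open_closedC.
  + exact: closed_openC.
  + by move=> t nV; split=> // /BV.
  + by move=> t [_ nB] /CB.
  + by rewrite setDE setCK setIC -setDE.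
- move=> {}B rB e e0.
  have /choice[CV CVP] : forall n, exists CV : set cantor_space * set cantor_space,
      [/\ closed CV.1, open CV.2, psi @^-1` CV.1 `<=` B n, B n `<=` psi @^-1` CV.2 &
        (nu (psi @^-1` (CV.2 `\` CV.1)) <= (e / 2 / (2 ^ n.+1)%:R)%:E)%E].
    move=> n; have [|C [V CVP]] := rB n (e / 2 / (2 ^ n.+1)%:R).
      by rewrite !divr_gt0// ltr0n expn_gt0.
    by exists (C, V).
  have cC n : closed (CV n).1 by have [] := CVP n.
  have oV n : open (CV n).2 by have [] := CVP n.
  (* The union of all the inner closed sets need not be closed; a finite part of it is, and loses
     less than a further [e / 2]. *)
  pose S n := \bigcup_(k < n) (CV k).1.
  have cS n : closed (S n) by apply: closed_bigcup; [exact: finite_II|].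
  have [|||N] := @probability_increasing_approx _ _ _ nu
      (fun n => psi @^-1` (S n)) (e / 2).
  + by move=> n; exact: measurable_preimage_closed.
  + by move=> n t [k /= kn Ck]; exists k => //=; exact: ltnW.
  + by rewrite divr_gt0.
  rewrite -preimage_bigcup => nuS.
  exists (S N), (\bigcup_n (CV n).2); split.
  + exact: cS.
  + exact: bigcup_open.
  + by move=> t [k _ Ck]; exists k => //; have [_ _ + _ _] := CVP k; apply.
  + by move=> t [k _ Bk]; exists k => //; have [_ _ _ + _] := CVP k; apply.
  pose E := \bigcup_n ((CV n).2 `\` (CV n).1).
  have mE n : measurable (psi @^-1` ((CV n).2 `\` (CV n).1) : set (borel T)).
    exact: (measurableD (measurable_preimage_open (oV n))
                        (measurable_preimage_closed (cC n))).
  have mV : measurable (psi @^-1` (\bigcup_n (CV n).2) : set (borel T)).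
    by apply: measurable_preimage_open; exact: bigcup_open.
  have mPE : measurable (psi @^-1` E : set (borel T)).
    by rewrite /E preimage_bigcup; exact: bigcupT_measurable.
  have mPS : measurable (psi @^-1` (\bigcup_n S n `\` S N) : set (borel T)).
    have mS : measurable (psi @^-1` (\bigcup_n S n) : set (borel T)).
      rewrite preimage_bigcup; apply: bigcupT_measurable => n.
      exact: measurable_preimage_closed.
    exact: (measurableD mS (measurable_preimage_closed (cS N))).
  apply: (@le_trans _ _ (nu (psi @^-1` E `|` psi @^-1` (\bigcup_n S n `\` S N)))).
    apply: le_measure; rewrite ?inE.
    + exact: (measurableD mV (measurable_preimage_closed (cS N))).
    + exact: measurableU.
    move=> t [[k _ Vk] nS].
    have [Ck|nCk] := pselect ((CV k).1 (psi t)); last by left; exists k.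
    by right; split=> //; exists k.+1 => //; exists k => /=.
  apply: (le_trans (measureU2 nu mPE mPS)).
  have nuE : (nu (psi @^-1` E) <= (e / 2)%:E)%E.
    rewrite /E preimage_bigcup; apply: probability_bigcup_le => //.
      by rewrite divr_ge0// ltW.
    by move=> n; have [] := CVP n.
  by apply: (le_trans (leeD nuE (ltW nuS))); rewrite -EFinD lee_fin; lra.
Qed.

(** The inner closed set from regularity, cut down by the closed set from tightness, has compact
    preimage. Two losses of [e / 3] leave the inequality strict. *)
Lemma radon_of_full (nu : borel_probability R T) :
  (forall n, nu (psi @^-1` U n) = 1%E) -> radon nu.
Proof.
move=> nuU B e mB e0.
have e30 : 0 < e / 3 by rewrite divr_gt0.
have [A [cA Apsi nuA]] := tight nuU e30.
have [C [V [cC oV CB BV nuCV]]] := borel_regular nu mB e30.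
exists (psi @^-1` (C `&` A)); split.
- by apply: compact_coordinates; [exact: closedI|move=> x [_ /Apsi]].
- by move=> t [/CB].
have mCV : measurable (psi @^-1` (V `\` C) : set (borel T)).
  exact: (measurableD (measurable_preimage_open oV) (measurable_preimage_closed cC)).
have mA : measurable (psi @^-1` (~` A) : set (borel T)).
  by apply: measurable_preimage_open; exact: closed_openC.
apply: (@le_lt_trans _ _ (nu (psi @^-1` (V `\` C) `|` psi @^-1` (~` A)))).
  apply: le_measure; rewrite ?inE.
  - by apply: measurableD => //; apply: measurable_preimage_closed; exact: closedI.
  - exact: measurableU.
  move=> t [Bt nCA]; have [Ct|nCt] := pselect (C (psi t)).
    by right=> At; apply: nCA.
  by left; split=> //; exact: BV.
apply: (le_lt_trans (measureU2 _ mCV mA)).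
by apply: (le_lt_trans (leeD nuCV nuA)); rewrite -EFinD lte_fin; lra.
Qed.

End Inside.
End Concentration.

(** * The Baire property *)

Section BorelRestriction.
Variables (R : realType) (T : ptopologicalType) (nu : probability (borel T) R).

(** Values on non-Borel sets are reset to 0, as [bp_nonborel] demands. *)
Definition borel_restriction (A : set (borel T)) : \bar R :=
  if pselect (measurable A) then nu A else 0%E.

Lemma borel_restrictionE A : measurable A -> borel_restriction A = nu A.
Proof. by rewrite /borel_restriction; case: pselect. Qed.

Let borel_restriction0 : borel_restriction set0 = 0%E.
Proof. by rewrite borel_restrictionE// measure0. Qed.

Let borel_restriction_ge0 A : (0 <= borel_restriction A)%E.
Proof.
by rewrite /borel_restriction; case: pselect => [mA|nA] /=; [exact: measure_ge0|].
Qed.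

Let borel_restriction_sigma_additive : semi_sigma_additive borel_restriction.
Proof.
move=> F mF tF mUF; rewrite borel_restrictionE//.
have -> : (fun n => \sum_(0 <= i < n) borel_restriction (F i))%E =
    (fun n => \sum_(0 <= i < n) nu (F i))%E.
  by apply/funext => n; apply: eq_bigr => i _; exact: borel_restrictionE.
exact: measure_semi_sigma_additive.
Qed.

HB.instance Definition _ := isMeasure.Build _ _ _ borel_restriction
  borel_restriction0 borel_restriction_ge0 borel_restriction_sigma_additive.

Let borel_restriction_setT : borel_restriction setT = 1%E.
Proof. by rewrite borel_restrictionE// probability_setT. Qed.

HB.instance Definition _ := Measure_isProbability.Build _ _ _
  borel_restriction borel_restriction_setT.

Lemma exists_borel_probability : exists mu : borel_probability R T,
  forall A : set (borel T), measurable A -> mu A = nu A.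
Proof.
have H (B : set (borel T)) : ~ measurable B -> borel_restriction B = 0%E.
  by rewrite /borel_restriction; case: pselect.
exists (@BorelProbability R T borel_restriction H) => A mA.
exact: borel_restrictionE.
Qed.

End BorelRestriction.

(** Compactness of [[0, 1]] gives a cluster point, and a cluster point of an ultrafilter is a
    limit. *)
Lemma ultra_cvg_itv (R : realType) (G : set_system nat) (f : nat -> R) :
    UltraFilter G -> (forall n, 0 <= f n <= 1) ->
  exists l : R, f @ G --> l.
Proof.
move=> UG f01.
have G01 : G (f @^-1` `[0, 1]) by apply: filterE => n /=; rewrite in_itv/= f01.
have [l [_ Gl]] := @segment_compact R 0 1 (f @ G) _ G01.
exists l => A lA; have [//|GA] := in_ultra_setVsetC (f @^-1` A) UG.
have GfA : G (f @^-1` (f @` (~` (f @^-1` A)))).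
  by apply: filterS GA => n nA; exists n.
have [_ [[n nA <-]]] := Gl (f @` (~` (f @^-1` A))) A GfA lA.
by move/nA.
Qed.

(** * The Baire argument for a closed set of Radon measures *)

Section RadonBaire.
Variables (R : realType) (T : ptopologicalType) (psi : T -> cantor_space).
Hypothesis psiP : cantor_coordinates psi.
Hypothesis psi_inj : injective psi.
Hypothesis psi_sep : forall K : nat -> set cantor_space,
  (forall n, closed (K n)) -> (forall n, K n `<=` range psi) ->
  exists U : nat -> set cantor_space,
    [/\ forall n, open (U n), forall n m, K n `<=` U m & \bigcap_n U n `<=` range psi].

Variable F : set (borel_probability R T).
Hypothesis F_radon : F `<=` @radon R T.
(** Closedness in the subspace of Radon measures, phrased inside the space of all measures. *)
Hypothesis F_closed : forall mu, radon mu ->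
  (forall A, nbhs mu A -> exists2 nu, F nu & A nu) -> F mu.

Lemma coordinates_continuous : continuous psi.
Proof.
move=> t A /nbhs_agreeP[n nA]; rewrite /fmap /=.
by apply/psiP; exists n => u; exact: nA.
Qed.

(** Each [D n] is carried up to [1/(k+1)] by a compact set. The images of these countably many
    compact sets are closed, so [psi_sep] encloses them all in every [U m]. *)
Lemma dense_full_cover (D : nat -> borel_probability R T) : (forall n, radon (D n)) ->
  exists U : nat -> set cantor_space, [/\ forall n, open (U n),
    forall n m, D n (psi @^-1` U m) = 1%E & \bigcap_n U n `<=` range psi].
Proof.
move=> rD.
have /choice[K KP] : forall nk : nat * nat, exists K : set T,
    compact K /\ (D nk.1 (~` (K : set (borel T))) < (nk.2.+1%:R^-1)%:E)%E.
  move=> [n k]; have [||K [cK _ DK]] := rD n setT (k.+1%:R^-1).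
  - exact: measurableT.
  - by rewrite invr_gt0.
  - by exists K; rewrite -setTD.
pose L (i : nat) := if unpickle i is Some nk then psi @` K nk else set0.
have cK nk : closed (psi @` K nk).
  apply: compact_closed cantor_space_hausdorff _.
  apply: continuous_compact (KP nk).1.
  by apply: continuous_subspaceT; exact: coordinates_continuous.
have [||U [oU LU Usub]] := @psi_sep L.
- by move=> i; rewrite /L; case: unpickle => [nk|]; [exact: cK|exact: closed0].
- by move=> i; rewrite /L; case: unpickle => [nk|] // x [t _ <-]; exists t.
exists U; split=> // n m.
have mU V : open V -> measurable (psi @^-1` V : set (borel T)).
  by move=> oV; apply: borel_open; exact: coordinates_preimage_open.
apply: probability_eq1 => [|k]; first exact: mU.
pose C := psi @` K (n, k).
have KC : K (n, k) = psi @^-1` C.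
  by apply/seteqP; split=> [t Kt|t [u Ku /psi_inj <-//]]; exists t.
have mC : measurable (psi @^-1` C : set (borel T)).
  rewrite -[C]setCK; apply: measurableC; apply: mU; apply: closed_openC; exact: cK.
exists (psi @^-1` C); split=> //.
  by move=> t Ct; apply: (LU (pickle (n, k)) m); rewrite /L pickleK.
by rewrite -KC; exact: (KP (n, k)).2.
Qed.
(** The non-strict form of [in_box], which survives passage to a limit. *)
Definition below (w : box) (q : seq bool -> R) : Prop :=
  forall p, p \in w -> ratr p.2 <= q p.1.

(** Rational thresholds strictly between the old ones and the values of [q] give a box whose closure
    lies in [w]. *)
Lemma shrink_box (w : box) (q : seq bool -> R) :
    (forall p, p \in w -> ratr p.2 < q p.1 :> R) ->
  exists w' : box, (forall p, p \in w' -> ratr p.2 < q p.1 :> R) /\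
    forall q', below w' q' -> forall p, p \in w -> ratr p.2 < q' p.1 :> R.
Proof.
move=> wq; have /choice[r rP] : forall p : seq bool * rat, exists r : rat,
    p \in w -> (ratr p.2 : R) < ratr r < q p.1.
  move=> p; have [pw|_] := boolP (p \in w); last by exists 0.
  by have [r] := rat_in_itvoo (wq p pw); rewrite in_itv/=; exists r.
exists [seq (p.1, r p) | p <- w]; split=> [_ /mapP[p pw ->] /=|q' wq' p pw].
  by have /andP[] := rP p pw.
have /andP[pr _] := rP p pw; apply: (lt_le_trans pr).
by apply: (wq' (p.1, r p)); apply/mapP; exists p.
Qed.

Lemma mass_pushforward (mu : probability (borel T) R)
    (m : probability (borel cantor_space) R) :
  (forall A, m A = mu (psi @^-1` A)) -> mass id m = mass psi mu.
Proof. by move=> mE; apply/funext => s; rewrite /mass mE. Qed.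

Variables (mu0 : borel_probability R T) (A0 : set (borel_probability R T)).
Hypotheses (F_mu0 : F mu0) (A0_mu0 : nbhs mu0 A0).
Variable V : (set (borel_probability R T))^nat.
Hypothesis V_open : forall n mu, F mu -> V n mu ->
  nbhs mu [set nu | F nu -> V n nu].
Hypothesis V_dense : forall n mu A, F mu -> nbhs mu A ->
  exists nu, [/\ F nu, A nu & V n nu].

Lemma box_dense_seq : exists D : nat -> borel_probability R T,
  (forall n, F (D n)) /\ forall w mu, F mu -> in_box psi w mu ->
    exists n, in_box psi w (D n).
Proof.
(* One element of [F] for each box that meets [F], and [mu0] for the others; boxes are countable. *)
pose d (w : box) := xget mu0 [set nu | F nu /\ in_box psi w nu].
have Fd w : F (d w) by rewrite /d; case: xgetP => // nu _ [].
exists (fun n => if unpickle n is Some w then d w else mu0); split.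
  by move=> n; case: unpickle.
move=> w mu Fmu wmu; exists (pickle w); rewrite pickleK /d.
by case: xgetP => [nu _ []//|/(_ mu)]; case.
Qed.

Section Game.
Variable U : nat -> set cantor_space.
Hypothesis U_open : forall n, open (U n).
Variable D : nat -> borel_probability R T.
Hypothesis D_full : forall n m, D n (psi @^-1` U m) = 1%E.
Hypothesis D_F : forall n, F (D n).
Hypothesis D_dense : forall w mu, F mu -> in_box psi w mu ->
  exists n, in_box psi w (D n).

Let state := {x : box * borel_probability R T | F x.2 /\ in_box psi x.1 x.2}.

(* [i] and [k] code the requirement [m (U i) > 1 - 1/(k+1)]. *)
Let good_step n i k (x y : state) : Prop :=
  forall m : probability (borel cantor_space) R, below (sval y).1 (mass id m) ->
    [/\ in_box id (sval x).1 m, ((1 - k.+1%:R^-1)%:E < m (U i))%E &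
      forall nu : borel_probability R T, mass psi nu = mass id m -> F nu -> V n nu].

Let next_state n i k x : exists y, good_step n i k x y.
Proof.
case: x => -[w mu] /= [Fmu wmu].
have [mu1 [Fmu1 wmu1 Vmu1]] := V_dense n Fmu (in_box_nbhs psiP wmu).
have [w1 [w1mu1 w1V]] := weak_nbhs_box psiP (V_open Fmu1 Vmu1).
(* [mu1] is exchanged for a member of [D] in the same boxes, because those are known to give [U i]
   full mass. *)
have [j] := D_dense Fmu1 (proj2 (in_box_cat psi w w1 mu1) (conj wmu1 w1mu1)).
move=> /in_box_cat[wd w1d].
have [dm dmE] := exists_pushforward (D j) (coordinates_measurable psiP).
have mdm := mass_pushforward dmE.
have dmU : ((1 - k.+1%:R^-1)%:E < dm (U i))%E.
  by rewrite dmE D_full lte_fin ltrBlDr ltrDl invr_gt0.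
have [w2 [w2dm w2U]] := open_box cantor_coordinates_id (U_open i) dmU.
have [|w' [w'd w'P]] := @shrink_box (w ++ w1 ++ w2) (mass psi (D j)).
  move=> p; rewrite !mem_cat => /orP[/wd//|/orP[/w1d//|/w2dm]].
  by rewrite mdm.
exists (exist _ (w', D j) (conj (D_F j) w'd)) => m /= /w'P{}w'P; split.
- by move=> p pw; apply: w'P; rewrite mem_cat pw.
- by apply: w2U => p pw; apply: w'P; rewrite !mem_cat pw !orbT.
- move=> nu num Fnu; apply: w1V => // p pw; rewrite num.
  by apply: w'P; rewrite !mem_cat pw orbT.
Qed.

Hypothesis U_sub : \bigcap_n U n `<=` range psi.

(** The cylinder masses of the successive [mu n] converge along an ultrafilter to an additive [p],
    which defines a measure [m] on the Cantor space. It satisfies the closed bounds of every box, so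
    each [U i] has mass 1 and [m] transfers to a Radon measure [nu] on [T], in the closure of
    [F]. *)
Lemma game_limit : exists nu, [/\ F nu, A0 nu & forall n, V n nu].
Proof.
have [w0 [w0mu0 w0A]] := weak_nbhs_box psiP A0_mu0.
pose x0 : state := exist _ (w0, mu0) (conj F_mu0 w0mu0).
(* Every requirement [(i, k)] is treated at the stage [pickle (i, k)]. *)
pose ik n : nat * nat := if unpickle n is Some ik then ik else (0, 0)%N.
have /choice[st stP] : forall nx : nat * state, exists y,
    good_step nx.1 (ik nx.1).1 (ik nx.1).2 nx.2 y.
  by move=> [n x]; exact: next_state.
pose x := fix x n := if n is n'.+1 then st (n', x n') else x0.
have xP n : good_step n (ik n).1 (ik n).2 (x n) (x n.+1) by exact: (stP (n, x n)).
pose w n := (sval (x n)).1; pose mu n := (sval (x n)).2.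
have Fmu n : F (mu n) by have [] := svalP (x n).
have wmu n : in_box psi (w n) (mu n) by have [] := svalP (x n).
(* [good_step] speaks of measures on the Cantor space, so [nu] is pushed there first. *)
have wS n (nu : borel_probability R T) : in_box psi (w n.+1) nu -> in_box psi (w n) nu.
  have [m mE] := exists_pushforward nu (coordinates_measurable psiP).
  have mnu := mass_pushforward mE => wnu.
  have [|wm _ _] := xP n m; first by move=> p pw; rewrite mnu ltW// wnu.
  by move=> p /wm; rewrite mnu.
have wle n d : in_box psi (w n) (mu (n + d)%N).
  elim: d n => [|d IH] n; first by rewrite addn0.
  by apply: wS; rewrite addnS -addSn; exact: IH.
have [G [UG oG]] := ultraFilterLemma (eventually_filter).
have /choice[p pP] : forall s, exists l : R, (fun n => mass psi (mu n) s) @ G --> l.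
  move=> s; apply: ultra_cvg_itv => n; rewrite (mass_ge0 psiP) /=.
  by rewrite -lee_fin -(massE psiP); exact: (probability_le1 (mu n) (cyl_measurable psiP s)).
(* [G] refines the eventual filter, so bounds valid from stage [n] on pass to the limit. *)
have p_ge s (a : R) n : (forall d, a <= mass psi (mu (n + d)%N) s) -> a <= p s.
  move=> H; apply: (closed_cvg (>= a)) (pP s); first exact: closed_ge.
  by apply: oG; exists n => // m /= /subnKC <-; exact: H.
have cyl_nil : cyl psi [::] = setT by apply/seteqP; split.
have p0 s : 0 <= p s by apply: (p_ge s 0 0%N) => d; exact: (mass_ge0 psiP).
have p1 : p [::] = 1.
  apply: cvg_unique (pP [::]) _ => //.
  rewrite (_ : (fun n => _) = cst 1); first exact: cvg_cst.
  by apply/funext => n; rewrite /mass cyl_nil probability_setT.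
have pS s : p s = p (rcons s false) + p (rcons s true).
  apply: cvg_unique (pP s) _ => //.
  rewrite (_ : (fun n => _) = (fun n => mass psi (mu n) (rcons s false) +
      mass psi (mu n) (rcons s true))); first exact: cvgD.
  apply/funext => n; apply: EFin_inj; rewrite EFinD -!(massE psiP).
  have cylS : cyl psi s = cyl psi (rcons s false) `|` cyl psi (rcons s true).
    apply/seteqP; split => t; rewrite /cyl /cylinder /= !size_rcons !mkseqS.
      by move=> ->; case: (psi t (size s)); [right|left].
    by move=> [/rcons_inj[]|/rcons_inj[]].
  rewrite cylS; apply: measureU; [exact: cyl_measurable|exact: cyl_measurable|].
  rewrite -subset0 => t [] /=; rewrite /cyl /cylinder /= !size_rcons.
  by move=> -> /rcons_inj[].
have [m mp] := exists_cantor_probability p0 p1 pS.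
have massm : mass id m = p by apply/funext => s; rewrite /mass mp.
have belowm n : below (w n) (mass id m).
  move=> q qw; rewrite massm; apply: (p_ge q.1 (ratr q.2) n) => d.
  by rewrite ltW//; exact: wle.
have mU i : m (U i) = 1%E.
  have mUi : measurable (U i : set (borel cantor_space)) by exact: borel_open.
  apply: probability_eq1 => // k; exists (U i); split=> //.
  have [_ + _] := xP (pickle (i, k)) m (belowm _).
  rewrite /ik pickleK /= probability_setC//.
  pose r : R := fine (m (U i)).
  have -> : m (U i) = r%:E by rewrite fineK// fin_num_measure.
  by rewrite -EFinB !lte_fin ltrBlDr addrC -ltrBlDr.
have [nu' nu'E] := transfer_probability psiP U_open U_sub mU.
have [nu nuE] := exists_borel_probability nu'.
have massnu : mass psi nu = mass id m.
  apply/funext => s; rewrite /mass nuE; last exact: cyl_measurable.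
  by rewrite nu'E//; apply: borel_open; exact: cylinder_open.
have Fnu : F nu.
  apply: F_closed.
    apply: (radon_of_full psiP U_open U_sub) => n.
    rewrite nuE ?nu'E//; first exact: borel_open.
    by apply: borel_open; exact: coordinates_preimage_open.
  (* A box around [nu] imposes finitely many strict bounds on limits, so [mu n] satisfies them for
     [G]-many [n]. *)
  move=> A /(weak_nbhs_box psiP)[v [vnu vA]].
  have : G [set n | in_box psi v (mu n)].
    elim: v vnu {vA} => [|q v IH] vnu; first by apply: filterE => n q.
    have /IH Gv : in_box psi v nu by move=> r rv; apply: vnu; rewrite inE rv orbT.
    have Gq : G [set n | ratr q.2 < mass psi (mu n) q.1].
      apply: (pP q.1 [set y | ratr q.2 < y]); apply: open_nbhs_nbhs; split.
        exact: open_gt.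
      by rewrite /= -massm -massnu; apply: vnu; rewrite mem_head.
    apply: filterS2 Gv Gq => n vn qn r; rewrite inE => /predU1P[->//|/vn//].
  by move=> /filter_ex[n vn]; exists (mu n) => //; exact: vA.
exists nu; split=> //.
  apply: w0A => q qw; rewrite massnu.
  by have [wm _ _] := xP 0%N m (belowm 1%N); exact: wm.
by move=> n; have [_ _] := xP n m (belowm n.+1); exact.
Qed.

End Game.

Lemma radon_baire : exists nu, [/\ F nu, A0 nu & forall n, V n nu].
Proof.
have [D [DF Dd]] := box_dense_seq.
have [U [oU DU Usub]] := dense_full_cover (fun n => F_radon (DF n)).
exact: (game_limit oU DU DF Dd Usub).
Qed.

End RadonBaire.

(** * Passage to subspaces and conclusion *)

Lemma nbhs_set_type (S : topologicalType) (A : set S) (z : A) (B : set A) :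
  nbhs z B <-> nbhs (set_val z) [set y | forall z' : A, set_val z' = y -> B z'].
Proof.
split=> [|H].
  rewrite (nbhsE z) => -[_ [[W oW <-] Wz] WB].
  apply: filterS (open_nbhs_nbhs (conj oW Wz)) => y Wy z' z'y.
  by apply: WB; rewrite /= z'y.
have Hz := @initial_continuous A S set_val z _ H.
by apply: (@filterS _ (nbhs z) _ _ _ _ Hz) => y; exact.
Qed.

(** [psi] inverts [cantor_real]; the inverse is continuous because points closer than
    [3^-1 ^+ n / 2] share their first [n] coordinates. *)
Lemma cantor_real_coordinates (R : realType) (X0 : set cantor_space)
    (X := [set cantor_real R x | x in X0]) (x0 : X) :
  exists psi : pointed_at x0 -> cantor_space,
    [/\ cantor_coordinates psi, injective psi & range psi = X0].
Proof.
have /choice[psi psiE] : forall t : X, exists x, X0 x /\ cantor_real R x = set_val t.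
  by move=> t; have /set_mem[x] := valP t; exists x.
exists psi; split.
- move=> t A; split=> [/nbhs_set_type|[n nA]].
    rewrite -(psiE t).2 => /nbhs_cantor_real[n nA]; exists n => u /nA H.
    by apply: H; rewrite (psiE u).2.
  apply/nbhs_set_type; rewrite -(psiE t).2.
  have e0 : 0 < (3^-1 : R) ^+ n / 2 by rewrite divr_gt0// exprn_gt0.
  have : nbhs (cantor_real R (psi t)) (ball (cantor_real R (psi t)) ((3^-1 : R) ^+ n / 2)).
    exact: nbhsx_ballx.
  apply: filterS => y ty u uy.
  by apply: nA; apply: (@cantor_real_agree R); rewrite (psiE u).2 uy.
- move=> t u tu; apply: val_inj.
  by have := (psiE t).2; rewrite tu (psiE u).2.
- apply/seteqP; split=> [_ [t _ <-]|x Xx]; first by have [] := psiE t.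
  have Xr : X (cantor_real R x) by exists x.
  pose t : X := Sub (cantor_real R x) (mem_set Xr).
  by exists t => //; apply: (@cantor_real_inj R); rewrite (psiE t).2.
Qed.

Lemma radon_hereditarily_baire (R : realType) (T : ptopologicalType)
    (psi : T -> cantor_space) :
  cantor_coordinates psi -> injective psi ->
  (forall K : nat -> set cantor_space,
    (forall n, closed (K n)) -> (forall n, K n `<=` range psi) ->
    exists U : nat -> set cantor_space,
      [/\ forall n, open (U n), forall n m, K n `<=` U m &
          \bigcap_n U n `<=` range psi]) ->
  hereditarily_baire (radon_probability R T).
Proof.
move=> psiP psi_inj psi_sep F cF U oU dU B [z0 Bz0] oB.
(* [F] is a subspace of a subspace; [pt] flattens both inclusions at once. *)
pose pt (z : F) : borel_probability R T := set_val (set_val z).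
have pt_inj z z' : pt z = pt z' -> z = z' by move=> zz'; do 2 apply: val_inj.
have nbhs_pt (z : F) (C : set F) :
    nbhs z C <-> nbhs (pt z) [set mu | forall z' : F, pt z' = mu -> C z'].
  rewrite nbhs_set_type nbhs_set_type; split; apply: filterS => mu H.
    by move=> z' z'mu; exact: (H (set_val z') z'mu z' erefl).
  by move=> y ymu z' z'y; apply: H; rewrite /pt z'y.
have nbhs_open (z : F) C : open C -> C z ->
    nbhs (pt z) [set mu | forall z' : F, pt z' = mu -> C z'].
  by move=> oC Cz; apply/nbhs_pt; exact: open_nbhs_nbhs.
have F_closed mu : radon mu ->
    (forall A, nbhs mu A -> exists2 nu, range pt nu & A nu) -> range pt mu.
  move=> rmu muF; pose y : radon_probability R T := Sub mu (mem_set rmu).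
  have Fy : F y.
    apply: cF => A /nbhs_set_type/muF[_ [z _ <-] zA].
    by exists (set_val z); split; [exact: set_valP|exact: zA].
  by exists (Sub y (mem_set Fy)).
have F_radon : range pt `<=` @radon R T.
  by move=> _ [z _ <-]; exact: (set_valP (set_val z)).
have [||||nu [[z _ <-] Bz Uz]] := @radon_baire R T psi psiP psi_inj psi_sep
    (range pt) F_radon F_closed (pt z0) [set mu | forall z : F, pt z = mu -> B z]
    _ _ (fun n => [set mu | exists2 z : F, pt z = mu & U n z]).
- by exists z0.
- exact: nbhs_open.
- move=> n _ _ [z <- Uz]; apply: filterS (nbhs_open z _ (oU n) Uz) => mu H.
  by move=> [z' _ z'mu]; exists z' => //; exact: H.
- move=> n _ A [z _ <-] /= nA.
  have : nbhs z [set z' | A (pt z')].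
    by apply/nbhs_pt; apply: filterS nA => mu Amu z' z'mu; rewrite /= z'mu.
  rewrite nbhsE => -[W [oW Wz] WA].
  have [z' [Wz' Uz']] := dU n W (ex_intro _ z Wz) oW.
  by exists (pt z'); split; [exists z'|exact: WA|exists z'].
exists z; split; first exact: Bz.
by move=> n _; have [z' /pt_inj <-] := Uz n.
Qed.

Theorem mainTheorem8 (R : realType) :
  exists X : set R,
    [/\ X `<=` `[0, 1],
        ~ Gdelta ((set_val : `[0, 1]%classic -> R) @^-1` X) &
        exists x0 : X,
          hereditarily_baire (radon_probability R (pointed_at x0))].
Proof.
have [X0 nG sepX0] := exists_separable_non_Gdelta.
have in01 x : `[0, 1]%classic (cantor_real R x).
  by rewrite /= in_itv/= cantor_real_itv.
exists [set cantor_real R x | x in X0]; split.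
- by move=> _ [x _ <-]; exact: in01.
- move=> [U oU XU]; apply: nG.
  (* A G-delta representation in the interval pulls back along the continuous [h] to one of [X0], by
     injectivity of [cantor_real]. *)
  pose h (x : cantor_space) : `[0, 1]%classic := Sub (cantor_real R x) (mem_set (in01 x)).
  exists (fun n => h @^-1` U n).
    move=> n; have [W oW WU] := oU n; rewrite -WU.
    have /continuousP := @cantor_real_continuous R.
    exact.
  rewrite -preimage_bigcap -XU; apply/seteqP; split=> x /=; first by exists x.
  by move=> [y Xy /cantor_real_inj <-].
- have [x Xx] : X0 !=set0.
    (* The base point exists because the empty set is open, hence G-delta. *)
    apply/set0P/eqP => X00; apply: nG; rewrite X00.
    by apply: open_Gdelta; exact: open0.
  have Xr : [set cantor_real R x | x in X0] (cantor_real R x) by exists x.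
  pose x0 : [set cantor_real R x | x in X0] := Sub (cantor_real R x) (mem_set Xr).
  exists x0; have [psi [psiP psi_inj psiX]] := cantor_real_coordinates x0.
  apply: (radon_hereditarily_baire psiP psi_inj) => K cK KX.
  by rewrite psiX; apply: sepX0 => // n; rewrite -psiX.
Qed.
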